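(* Let $\mathfrak{g}=\mathfrak{sl}_4(\mathbb{C})$ with $I=\{1,2,3\}$, where $2$ is the non-leaf node of the Dynkin diagram, and let $$\mathbb{M}=M(0)\big/\big(U\mathfrak{g}\,f_1f_3M(0)_0+U\mathfrak{g}\,f_2M(0)_0\big).$$ Then $\mathrm{ch}\,\mathbb{M}=N\big/\prod_{\alpha\in\Delta^+}(1-e^{-\alpha})$, where $$\begin{aligned}N=\ &e^{0}-e^{s_2\bullet0}-e^{s_1s_3\bullet0}+e^{s_1s_3s_2\bullet0}+e^{s_2s_1s_3\bullet0}\\&+e^{s_3s_2s_1\bullet0}+e^{s_1s_2s_3\bullet0}\\&-e^{s_2s_3s_2s_1\bullet0}-e^{s_1s_3s_2s_1\bullet0}-e^{s_2s_1s_2s_3\bullet0}-e^{s_3s_1s_2s_3\bullet0}\\&+e^{s_2s_1s_3s_2s_1\bullet0}+e^{s_2s_3s_1s_2s_3\bullet0}\\&-e^{s_2s_1s_3s_2\bullet0}+e^{s_1s_3s_2s_1s_3\bullet0}\\&-e^{w_0\bullet0}.\end{aligned}$$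
   Context: $M(0)$ is the Verma module of highest weight $0$, $f_i$ are the Chevalley lowering generators, $\Delta^+$ the positive roots, $s_i$ the simple reflections, $w_0$ the longest element of the Weyl group, $w\bullet\lambda=w(\lambda+\rho)-\rho$ with $\rho$ the half-sum of positive roots, and $\mathrm{ch}$ the formal character. *)

(* Defs.v *)
From HB Require Import structures.
From mathcomp Require Import all_boot all_order all_algebra.
From mathcomp Require Import generic_quotient ring_quotient.
From mathcomp Require Import boolp classical_sets functions fsbigop.
From mathcomp Require Import reals complex.
From mathcomp Require finmap.
From mathcomp.multinomials Require Import monalg.

Set Implicit Arguments.
Unset Strict Implicit.
Unset Printing Implicit Defensive.

Import GRing.Theory Num.Theory.
Import Quotient.
Local Open Scope ring_scope.
Local Open Scope quotient_scope.
Local Open Scope classical_set_scope.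

Section Submodules.
Context {A : pzRingType} {V : lmodType A}.

Definition submod_span (S : set V) : {pred V} := fun v => `[< exists l : seq (A * V),
  (forall p, p \in l -> S p.2) /\ v = \sum_(p <- l) p.1 *: p.2 >].

Lemma submod_span_closed (S : set V) : submod_closed (submod_span S).
Proof.
split; first by apply/asboolP; exists [::]; split=> //; rewrite big_nil.
move=> a u v /asboolP[lu [Su ->]] /asboolP[lv [Sv ->]]; apply/asboolP.
exists ([seq (a * p.1, p.2) | p <- lu] ++ lv); split.
  by move=> p; rewrite mem_cat => /orP[/mapP[q /Su ? ->]|/Sv].
rewrite big_cat big_map scaler_sumr /=; congr (_ + _).
by apply: eq_bigr => p _; rewrite scalerA.
Qed.

HB.instance Definition _ (S : set V) :=
  GRing.isSubmodClosed.Build A V (submod_span S) (submod_span_closed S).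

Definition addsm (P Q : submodClosed V) : {pred V} := fun v =>
  `[< exists p q, [/\ p \in P, q \in Q & v = p + q] >].

Lemma addsm_closed (P Q : submodClosed V) : submod_closed (addsm P Q).
Proof.
split; first by apply/asboolP; exists 0, 0; rewrite !rpred0 addr0.
move=> a u v /asboolP[p [q [Pp Qq ->]]] /asboolP[p' [q' [Pp' Qq' ->]]].
apply/asboolP; exists (a *: p + p'), (a *: q + q').
by rewrite !(rpredD, rpredZ) // scalerDr addrACA.
Qed.

HB.instance Definition _ (P Q : submodClosed V) :=
  GRing.isSubmodClosed.Build A V (addsm P Q) (addsm_closed P Q).

End Submodules.

Section QuotientModule.
Context (A : pzRingType) (V : lmodType A) (W : submodClosed V).

(* submodClosed carries no closure under opposite (it is also meant for      *)
(* semimodules), which {quot _} requires.                                 *)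
Definition submod_pred : {pred V} := W.

Lemma submod_pred_zmod : zmod_closed submod_pred.
Proof. exact/GRing.submod_closedB/submodClosedP. Qed.

HB.instance Definition _ :=
  GRing.isZmodClosed.Build V submod_pred submod_pred_zmod.

Definition quotmod := {quot submod_pred}.

HB.instance Definition _ := GRing.Zmodule.on quotmod.
HB.instance Definition _ : EqQuotient V (equiv submod_pred) quotmod :=
  EqQuotient.on quotmod.

Definition quotmod_scale (a : A) (x : quotmod) : quotmod :=
  \pi_quotmod (a *: repr x).

Lemma quotmod_piB (x y : V) :
  (\pi_quotmod x == \pi_quotmod y) = (x - y \in W).
Proof. exact: esym (idealrBE submod_pred x y). Qed.

Lemma quotmod_piD (x y : V) :
  \pi_quotmod (x + y) = \pi_quotmod x + \pi_quotmod y.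
Proof. exact: (@pi_addr _ _ _ _ _ {quot submod_pred}). Qed.

Lemma quotmod_piZ (a : A) (x : V) :
  \pi_quotmod (a *: x) = quotmod_scale a (\pi_quotmod x).
Proof.
apply/eqP; rewrite quotmod_piB -scalerBr; apply: rpredZ; rewrite -quotmod_piB.
by rewrite reprK.
Qed.

Lemma quotmod_scaleA a b (x : quotmod) :
  quotmod_scale a (quotmod_scale b x) = quotmod_scale (a * b) x.
Proof. by rewrite -[x]reprK -!quotmod_piZ scalerA reprK. Qed.

Lemma quotmod_scale1 : left_id 1 quotmod_scale.
Proof. by move=> x; rewrite -[x]reprK -quotmod_piZ scale1r. Qed.

Lemma quotmod_scaleDr : right_distributive quotmod_scale +%R.
Proof.
move=> a x y; rewrite -[x]reprK -[y]reprK -quotmod_piD -!quotmod_piZ.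
by rewrite -quotmod_piD scalerDr.
Qed.

Lemma quotmod_scaleDl x : {morph quotmod_scale^~ x : a b / a + b}.
Proof.
by move=> a b; rewrite -[x]reprK -!quotmod_piZ -quotmod_piD scalerDl.
Qed.

HB.instance Definition _ := GRing.Zmodule_isLmodule.Build A quotmod
  quotmod_scaleA quotmod_scale1 quotmod_scaleDr quotmod_scaleDl.

End QuotientModule.

(* The universal enveloping algebra of a Lie algebra g with bracket br:   *)
(* the free algebra on the elements of g modulo the two-sided ideal making *)
(* g -> U linear and sending brackets to commutators, i.e. T(g) modulo    *)
(* x (x) y - y (x) x - [x, y].                                            *)

Section EnvelopingAlgebra.
Context (K : comNzRingType) (g : lmodType K) (br : g -> g -> g).

Local Notation freealg := {malg K[{fmonom g}]}.

Definition freevar (x : g) : freealg := << fmu x >>.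

Definition env_rel : set freealg := [set r |
  (exists a x y, r = freevar (a *: x + y) - (a *: freevar x + freevar y)) \/
  (exists x y,
     r = freevar x * freevar y - freevar y * freevar x - freevar (br x y))].

Definition env_ideal : {pred freealg} := fun r =>
  `[< exists l : seq (freealg * freealg * freealg),
      (forall p, p \in l -> env_rel p.1.2) /\
      r = \sum_(p <- l) p.1.1 * p.1.2 * p.2 >].

Lemma env_idealMl a x : x \in env_ideal -> a * x \in env_ideal.
Proof.
move=> /asboolP[l [Hl ->]]; apply/asboolP.
exists [seq ((a * p.1.1, p.1.2), p.2) | p <- l]; split.
  by move=> _ /mapP[p /Hl ? ->].
by rewrite big_map mulr_sumr; apply: eq_bigr => p _; rewrite !mulrA.
Qed.

Lemma env_idealMr a x : x \in env_ideal -> x * a \in env_ideal.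
Proof.
move=> /asboolP[l [Hl ->]]; apply/asboolP.
exists [seq ((p.1.1, p.1.2), p.2 * a) | p <- l]; split.
  by move=> _ /mapP[p /Hl ? ->].
by rewrite big_map mulr_suml; apply: eq_bigr => p _; rewrite !mulrA.
Qed.

Lemma env_ideal_zmod : zmod_closed env_ideal.
Proof.
split; first by apply/asboolP; exists [::]; split=> //; rewrite big_nil.
move=> x y xI /(env_idealMl (-1)); rewrite mulN1r.
move: xI => /asboolP[l [Hl ->]] /asboolP[l' [Hl' ->]]; apply/asboolP.
exists (l ++ l'); split; last by rewrite big_cat.
by move=> p; rewrite mem_cat => /orP[/Hl|/Hl'].
Qed.

HB.instance Definition _ :=
  GRing.isZmodClosed.Build freealg env_ideal env_ideal_zmod.

Lemma env_idealZ a x : x \in env_ideal -> a *: x \in env_ideal.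
Proof. by rewrite -[x in a *: x]mul1r scalerAl => /env_idealMl; apply. Qed.

Definition env := {quot env_ideal}.

HB.instance Definition _ := GRing.Zmodule.on env.
HB.instance Definition _ : EqQuotient freealg (equiv env_ideal) env :=
  EqQuotient.on env.

Lemma env_piB (x y : freealg) :
  (\pi_env x == \pi_env y) = (x - y \in env_ideal).
Proof. exact: esym (idealrBE env_ideal x y). Qed.

Lemma env_piD (x y : freealg) : \pi_env (x + y) = \pi_env x + \pi_env y.
Proof. exact: (@pi_addr _ _ _ _ _ {quot env_ideal}). Qed.

Definition env_one : env := \pi_env 1.
Definition env_mul (x y : env) : env := \pi_env (repr x * repr y).
Definition env_scale (a : K) (x : env) : env := \pi_env (a *: repr x).

Lemma env_piM (x y : freealg) :
  \pi_env (x * y) = env_mul (\pi_env x) (\pi_env y).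
Proof.
apply/eqP; rewrite env_piB.
set x' := repr (\pi_env x); set y' := repr (\pi_env y).
have -> : x * y - x' * y' = x * (y - y') + (x - x') * y'.
  by rewrite mulrBr mulrBl addrA subrK.
by apply: rpredD; [apply: env_idealMl|apply: env_idealMr];
  rewrite -env_piB reprK.
Qed.

Lemma env_piZ (a : K) (x : freealg) :
  \pi_env (a *: x) = env_scale a (\pi_env x).
Proof.
apply/eqP; rewrite env_piB -scalerBr env_idealZ // -env_piB.
by rewrite reprK.
Qed.

Lemma env_mulA : associative env_mul.
Proof.
move=> x y z; rewrite -[x]reprK -[y]reprK -[z]reprK.
move: (repr x) (repr y) (repr z) => {}x {}y {}z.
by rewrite -(env_piM y z) -(env_piM x y) -!env_piM mulrA.
Qed.

Lemma env_mul1 : left_id env_one env_mul.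
Proof. by move=> x; rewrite -[x]reprK -env_piM mul1r. Qed.

Lemma env_mulr1 : right_id env_one env_mul.
Proof. by move=> x; rewrite -[x]reprK -env_piM mulr1. Qed.

Lemma env_mulDl : left_distributive env_mul +%R.
Proof.
move=> x y z; rewrite -[x]reprK -[y]reprK -[z]reprK.
by rewrite -env_piD -!env_piM -env_piD mulrDl.
Qed.

Lemma env_mulDr : right_distributive env_mul +%R.
Proof.
move=> x y z; rewrite -[x]reprK -[y]reprK -[z]reprK.
by rewrite -env_piD -!env_piM -env_piD mulrDr.
Qed.

(* The ideal is proper: its elements have no constant term. *)
Lemma env_one_neq0 : env_one != 0.
Proof.
have pi0 : 0 = \pi_env 0 by apply: (addIr (\pi_env 0)); rewrite -env_piD !add0r.
rewrite pi0 env_piB subr0; apply/asboolP => -[l [Hl]].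
pose e : {fmonom g} := @mone _.
have var0 x : (freevar x)@_e = 0.
  rewrite /freevar mcoeffU; case: eqP => // /(congr1 (@fmonom_val g)).
  by rewrite fm1 /fmu fmE.
have rel0 r : env_rel r -> r@_e = 0.
  case=> [[a [x [y ->]]]|[x [y ->]]].
    by rewrite !(mcoeffB, mcoeffD, mcoeffZ) !var0 mulr0 addr0 subrr.
  by rewrite !mcoeffB !rmorphM /= !var0 mulr0 !subr0.
move/(congr1 (mcoeff e)); rewrite rmorph1 raddf_sum /= big_seq big1.
  by move/eqP; rewrite oner_eq0.
by move=> p pl; rewrite !rmorphM /= (rel0 _ (Hl p pl)) mulr0 mul0r.
Qed.

HB.instance Definition _ := GRing.Zmodule_isNzRing.Build env
  env_mulA env_mul1 env_mulr1 env_mulDl env_mulDr env_one_neq0.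

Lemma env_scaleA a b x : env_scale a (env_scale b x) = env_scale (a * b) x.
Proof. by rewrite -[x]reprK -!env_piZ scalerA reprK. Qed.

Lemma env_scale1 : left_id 1 env_scale.
Proof. by move=> x; rewrite -[x]reprK -env_piZ scale1r. Qed.

Lemma env_scaleDr : right_distributive env_scale +%R.
Proof.
move=> a x y; rewrite -[x]reprK -[y]reprK -env_piD -!env_piZ.
by rewrite -env_piD scalerDr.
Qed.

Lemma env_scaleDl x : {morph env_scale^~ x : a b / a + b}.
Proof. by move=> a b; rewrite -[x]reprK -!env_piZ -env_piD scalerDl. Qed.

HB.instance Definition _ := GRing.Zmodule_isLmodule.Build K env
  env_scaleA env_scale1 env_scaleDr env_scaleDl.

Lemma env_scaleAl (a : K) (x y : env) : a *: (x * y) = a *: x * y.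
Proof.
rewrite -[x]reprK -[y]reprK /GRing.scale /GRing.mul /=.
by rewrite -env_piM -!env_piZ -env_piM scalerAl.
Qed.

HB.instance Definition _ := GRing.Lmodule_isLalgebra.Build K env env_scaleAl.

Lemma env_scaleAr (a : K) (x y : env) : a *: (x * y) = x * (a *: y).
Proof.
rewrite -[x]reprK -[y]reprK /GRing.scale /GRing.mul /=.
rewrite -env_piM -!env_piZ -env_piM; congr (\pi_env _).
set u := repr x; set v := repr y.
apply/malgP => k; rewrite mcoeffZ.
rewrite (mcoeffMlw k (finmap.fsubset_refl (msupp u)) (finmap.fsubset_refl (msupp v))).
rewrite (mcoeffMlw k (finmap.fsubset_refl (msupp u)) (msuppZ_le a v)).
rewrite mulr_sumr; apply: eq_bigr => i _.
rewrite mulr_sumr; apply: eq_bigr => j _.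
by rewrite mcoeffZ mulrnAr mulrCA.
Qed.

HB.instance Definition _ := GRing.Lalgebra_isAlgebra.Build K env env_scaleAr.

(* The canonical map g -> U(g). *)
Definition env_inj (x : g) : env := \pi_env (freevar x).

Lemma env_rel_ideal r : env_rel r -> r \in env_ideal.
Proof.
move=> Hr; apply/asboolP; exists [:: ((1, r), 1)]; split.
  by move=> p; rewrite mem_seq1 => /eqP ->.
by rewrite big_seq1 mul1r mulr1.
Qed.

Lemma env_inj_linear a x y :
  env_inj (a *: x + y) = a *: env_inj x + env_inj y.
Proof.
rewrite /env_inj [RHS](_ : _ = \pi_env (a *: freevar x + freevar y)).
  apply/eqP; rewrite env_piB; apply: env_rel_ideal.
  by left; exists a, x, y.
by rewrite env_piD env_piZ.
Qed.

Lemma env_inj_br x y :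
  env_inj (br x y) = env_inj x * env_inj y - env_inj y * env_inj x.
Proof.
apply/esym/eqP; rewrite subr_eq addrC.
rewrite [X in X == _](_ : _ = \pi_env (freevar x * freevar y)).
  rewrite [X in _ == X](_ : _ =
    \pi_env (freevar y * freevar x + freevar (br x y))).
    rewrite env_piB; apply: env_rel_ideal.
    by right; exists x, y; rewrite opprD addrA.
  by rewrite env_piD env_piM.
by rewrite env_piM.
Qed.

End EnvelopingAlgebra.

Section SL4.
Context (K : fieldType).

Definition trace0 : {pred 'M[K]_4} := fun A => \tr A == 0.

Lemma trace0_closed : submod_closed trace0.
Proof.
split; first by rewrite /in_mem /= /trace0 mxtrace0.
move=> a A B /eqP trA /eqP trB; apply/eqP.
by rewrite mxtraceD mxtraceZ trA trB mulr0 addr0.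
Qed.

HB.instance Definition _ :=
  GRing.isSubmodClosed.Build K 'M[K]_4 trace0 trace0_closed.

Record sl4 : predArgType := Sl4 { sl4_mx :> 'M[K]_4; _ : sl4_mx \in trace0 }.

HB.instance Definition _ := [isSub for sl4_mx].
HB.instance Definition _ := [Choice of sl4 by <:].
HB.instance Definition _ := [SubChoice_isSubLmodule of sl4 by <:].

Lemma sl4_br_subproof (A B : 'M[K]_4) : A *m B - B *m A \in trace0.
Proof. by apply/eqP; rewrite raddfB /= mxtrace_mulC subrr. Qed.

Definition sl4_br (x y : sl4) : sl4 := Sl4 (sl4_br_subproof x y).

(* Node k : 'I_3 of the Dynkin diagram sits between the matrix indices    *)
(* node_lo k = k and node_hi k = k + 1. *)
Definition node_lo (k : 'I_3) : 'I_4 := widen_ord (leqnSn 3) k.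
Definition node_hi (k : 'I_3) : 'I_4 := lift ord0 k.

Lemma sl4_f_subproof k : delta_mx (node_hi k) (node_lo k) \in trace0.
Proof.
apply/eqP; rewrite /mxtrace big1 // => i _; rewrite mxE.
case: eqP => //= ->; rewrite (_ : _ == _ = false) //.
by apply/negbTE; rewrite -val_eqE /= eqn_leq ltnn.
Qed.

Lemma sl4_h_subproof k :
  delta_mx (node_lo k) (node_lo k) - delta_mx (node_hi k) (node_hi k)
    \in trace0.
Proof.
have tr1 (i : 'I_4) : \tr (delta_mx i i : 'M[K]_4) = 1.
  rewrite /mxtrace (bigD1 i) //= mxE eqxx big1 ?addr0 // => j /negbTE ji.
  by rewrite mxE ji.
by apply/eqP; rewrite raddfB /= !tr1 subrr.
Qed.

Definition sl4_f (k : 'I_3) : sl4 := Sl4 (sl4_f_subproof k).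
Definition sl4_h (k : 'I_3) : sl4 := Sl4 (sl4_h_subproof k).

Definition sl4_upper (x : sl4) := forall i j : 'I_4, (j <= i)%N -> x i j = 0.

(* A weight, i.e. a linear functional on the diagonal traceless matrices, *)
(* is the row of its values at the basis h_1, h_2, h_3. *)
Definition weight := 'rV[K]_3.

HB.instance Definition _ := GRing.Lmodule.on weight.

(* The functional H |-> H_ii - H_jj. *)
Definition sl4_root (i j : 'I_4) : weight := \row_k (sl4_h k i i - sl4_h k j j).

Definition simple_root (k : 'I_3) : weight := sl4_root (node_lo k) (node_hi k).

Definition rho : weight :=
  2^-1 *: \sum_(p : 'I_4 * 'I_4 | (p.1 < p.2)%N) sl4_root p.1 p.2.

Definition simple_reflection (k : 'I_3) (mu : weight) : weight :=
  mu - mu 0 k *: simple_root k.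

(* Weyl group elements are given by words in the simple reflections; the  *)
(* word [:: i; j; ...] denotes s_i s_j ..., so its last letter acts first. *)
Definition weyl_act (w : seq 'I_3) (mu : weight) : weight :=
  foldr simple_reflection mu w.

Definition dot_act (w : seq 'I_3) (lam : weight) : weight :=
  weyl_act w (lam + rho) - rho.

Definition reduced (w : seq 'I_3) := forall w' : seq 'I_3,
  weyl_act w' =1 weyl_act w -> (size w <= size w')%N.

(* w is a reduced word for the longest element of the Weyl group. *)
Definition longest_word (w : seq 'I_3) :=
  reduced w /\ forall w' : seq 'I_3, reduced w' -> (size w' <= size w)%N.

End SL4.

Definition node1 : 'I_3 := @Ordinal 3 0 isT.
Definition node2 : 'I_3 := @Ordinal 3 1 isT.
Definition node3 : 'I_3 := @Ordinal 3 2 isT.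

(* Formal characters: functions on weights, f standing for the possibly   *)
(* infinite sum of f(mu) e^mu.                                            *)

Section FormalCharacters.
Context (K : fieldType).
Local Notation weight := (weight K).

Definition fchar := weight -> int.

HB.instance Definition _ := GRing.Zmodule.on fchar.

Definition fexp (lam : weight) : fchar := fun mu => (mu == lam)%:Z.

(* The convolution product; the sum is over the finitely many weights nu  *)
(* with nonzero summand, for the pairs that have a product. *)
Definition fmul (f g : fchar) : fchar := fun mu =>
  \sum_(nu \in [set: weight]) f nu * g (mu - nu).

(* 1 / (1 - e^(-a)), expanded as the sum of e^(-k a) over k >= 0. *)
Definition fgeom (a : weight) : fchar := fun mu =>
  `[< exists k : nat, mu = - (a *+ k) >]%:Z.

Lemma fgeomP (a : weight) : [pchar K] =i pred0 -> a != 0 ->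
  fmul (fexp 0 - fexp (- a)) (fgeom a) = fexp 0.
Proof.
move=> charK a0; apply/funext => mu.
have na0 : 0 != - a by rewrite eq_sym oppr_eq0.
rewrite /fmul (@fsbigE _ _ _ _ _ [:: 0; - a]) /= ?inE ?na0 //; last first.
  move=> nu _; rewrite !inE negb_or => /andP[/negbTE n0 /negbTE na].
  by rewrite -[X in X * _]/(fexp 0 nu - fexp (- a) nu) /fexp n0 na mul0r.
rewrite !big_cons big_nil !in_setT.
rewrite -[(fexp 0 - fexp (- a)) 0]/(fexp 0 0 - fexp (- a) 0).
rewrite -[(fexp 0 - fexp (- a)) (- a)]/(fexp 0 (- a) - fexp (- a) (- a)).
rewrite /fexp !eqxx (negbTE na0) oppr_eq0 (negbTE a0) subr0 sub0r mul1r addr0.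
rewrite mulN1r subr0 opprK /fgeom.
have a_inj k : a *+ k.+1 != 0.
  by rewrite -scaler_nat scaler_eq0 (negbTE a0) orbF (proj1 (pcharf0P _) charK).
have [->|mu0] := eqVneq mu 0.
  rewrite add0r asboolT; last by exists 0%N; rewrite mulr0n oppr0.
  rewrite asboolF ?subr0 // => -[k /eqP].
  by rewrite -addr_eq0 -mulrS (negbTE (a_inj k)).
apply/eqP; rewrite subr_eq0; apply/eqP; congr (Posz (nat_of_bool _)).
apply/asbool_equiv_eq; split=> -[[|k] Hk].
- by move: mu0; rewrite Hk mulr0n oppr0 eqxx.
- by exists k; rewrite Hk mulrS opprD addrAC addNr add0r.
- by exists 1%N; apply/eqP; rewrite mulr1n -addr_eq0 Hk mulr0n oppr0.
- exists k.+2; apply/(addIr a).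
  by rewrite Hk (mulrS a k.+1) opprD addrAC addNr add0r.
Qed.

(* 1 / prod_(a > 0) (1 - e^(-a)). *)
Definition weyl_denom_inv : fchar :=
  \big[fmul/fexp 0]_(p : 'I_4 * 'I_4 | (p.1 < p.2)%N)
    fgeom (sl4_root K p.1 p.2).

End FormalCharacters.

Arguments weyl_denom_inv K _ : clear implicits.

Section Modules.
Context (K : fieldType).

Definition Usl4 := env (@sl4_br K).

HB.instance Definition _ := GRing.Algebra.on Usl4.

Definition U_inj (x : sl4 K) : Usl4 := env_inj (@sl4_br K) x.

(* The h_k span the Cartan subalgebra, so it is enough to let them act.    *)
Definition wt_space (V : lmodType Usl4) (mu : weight K) : set V :=
  [set v | forall k, U_inj (sl4_h K k) *: v = (mu 0 k)%:A *: v].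

(* Generators of the left ideal I(lam) with M(lam) = U(g) / I(lam): the    *)
(* x in n^+, and the h - lam(h) for h in a basis of the Cartan subalgebra. *)
Definition verma_gens (lam : weight K) : set (Usl4^o) := [set u |
  (exists2 x, sl4_upper x & u = U_inj x) \/
  (exists k, u = U_inj (sl4_h K k) - (lam 0 k)%:A)].

Definition verma (lam : weight K) : lmodType Usl4 :=
  quotmod (submod_span (verma_gens lam)).

(* W is a K-subspace of V of dimension n. *)
Definition has_dim (V : lmodType Usl4) (W : set V) (n : nat) :=
  exists2 b : 'I_n -> V,
    (forall c : 'I_n -> K, \sum_i (c i)%:A *: b i = 0 -> forall i, c i = 0) &
    (forall v, W v <-> exists c : 'I_n -> K, v = \sum_i (c i)%:A *: b i).

(* ch V = f; in particular the weight spaces are finite-dimensional. *)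
Definition has_char (V : lmodType Usl4) (f : fchar K) :=
  forall mu, exists2 n, has_dim (@wt_space V mu) n & f mu = n%:Z.

(* U(g) f_1 f_3 M(0)_0. *)
Definition MM_sub13 : {pred verma 0} :=
  submod_span [set U_inj (sl4_f K node1) * U_inj (sl4_f K node3) *: m
       | m in @wt_space (verma 0) 0].

(* U(g) f_2 M(0)_0. *)
Definition MM_sub2 : {pred verma 0} :=
  submod_span [set U_inj (sl4_f K node2) *: m | m in @wt_space (verma 0) 0].

Definition MM : lmodType Usl4 := quotmod (addsm MM_sub13 MM_sub2).

End Modules.

(* Main.v *)
Require Import Defs.
From HB Require Import structures.
From mathcomp Require Import all_boot all_order all_algebra.
From mathcomp Require Import generic_quotient ring_quotient.
From mathcomp Require Import boolp classical_sets functions fsbigop.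
From mathcomp Require Import reals complex.
From mathcomp Require finmap.
From mathcomp.multinomials Require Import monalg.
From mathcomp Require Import ring lra zify.

(** Number the rows and columns of matrices from 0 and write a = f_1 = E_10,
    c = f_3 = E_32, f = f_2 = E_21, b = [f, a] = E_20, d = [f, c] = - E_31 and
    z = [a, d] = E_30. Then a, b, c, d, z span a Heisenberg algebra with centre z,
    normalised by f, and MM is generated by a vector v that is killed by n^+, by
    the Cartan subalgebra, by f and by a c.

    Spanning. Applying f to a c v = 0 gives (a d + b c) v = 0 and b d v = 0. From
    these follow a a d v = d d a v = 0 and, by the symmetry that exchanges (a, b)
    with (c, d), c c b v = b b c v = 0. With these relations f_1, f_2 and f_3
    preserve the span of v and of the two families
      z^k a^i b^j v (i + j > 0),  z^k d a v     and
      z^k c^i d^j v (i + j > 0),  z^k b c v,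
    where z v = - (d a + b c) v (span_a, span_c, span_f). A subspace that contains v
    and is stable under the f_i is all of MM (lower_span_env, MM_cyclic).

    Independence. MM maps to the parabolic Verma modules M(0) / (f_2, f_3) and
    M(0) / (f_1, f_2), since f_1 f_3 = f_3 f_1 and f_2 kill their highest weight
    lines (MM_map, null_vac1, null_vac2). Both are realised, up to completion, on
    functions on a lattice. The first family goes to nonzero multiples of distinct
    Dirac functions in the first module and to 0 in the second; the second family
    behaves the other way round. So v and the two families form a basis
    (coord_dual, expands_all), and
      ch MM = 1 / ((1 - x) (1 - x y) (1 - x y t)) + 1 / ((1 - t) (1 - y t) (1 - x y t)) - 1,
    where x, y, t are the exponentials of the negative simple roots (wt_char).

    Numerator. Multiplying by the six factors of the Weyl denominator turns this into
    a polynomial in x, y, t, which is N term by term (numer_identity). The last term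
    of N does not depend on the chosen word w0, because the longest element of the
    Weyl group is unique and sends rho to - rho (longest_rho). *)

Set Implicit Arguments.
Unset Strict Implicit.
Unset Printing Implicit Defensive.

Import Order.TTheory GRing.Theory Num.Theory.
Local Open Scope ring_scope.
Local Open Scope quotient_scope.

Local Notation i0 := (@Ordinal 4 0 isT).
Local Notation i1 := (@Ordinal 4 1 isT).
Local Notation i2 := (@Ordinal 4 2 isT).
Local Notation i3 := (@Ordinal 4 3 isT).

(** * Linear maps out of spans and quotients *)

Lemma quotmod_lift (A : pzRingType) (V V' : lmodType A) (W : submodClosed V)
    (h : {linear V -> V'}) : (forall w, w \in W -> h w = 0) ->
  exists h' : {linear quotmod W -> V'}, forall x, h' (\pi_(quotmod W) x) = h x.
Proof.
move=> hW.
have hpi x : h (repr (\pi_(quotmod W) x)) = h x.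
  apply/eqP; rewrite -subr_eq0 -linearB; apply/eqP/hW.
  by rewrite -quotmod_piB reprK.
pose h0 (q : quotmod W) : V' := h (repr q).
have lin : linear h0.
  move=> a x y; rewrite /h0.
  have -> : a *: x + y = \pi_(quotmod W) (a *: repr x + repr y).
    by rewrite quotmod_piD quotmod_piZ !reprK.
  by rewrite hpi linearP.
pose mix := GRing.isLinear.Build A (quotmod W) V' *:%R h0 lin.
pose h' : {linear quotmod W -> V'} := HB.pack h0 mix.
by exists h'.
Qed.

Lemma submod_span_gen (A : pzRingType) (V : lmodType A) (X : set V) x :
  X x -> x \in submod_span X.
Proof.
move=> Xx; apply/asboolP; exists [:: (1, x)]; split.
  by move=> p; rewrite mem_seq1 => /eqP ->.
by rewrite big_seq1 scale1r.
Qed.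

Lemma span_kill (A : pzRingType) (V V' : lmodType A) (h : {linear V -> V'})
    (S : set V) : (forall s, S s -> h s = 0) ->
  forall w, w \in submod_span S -> h w = 0.
Proof.
move=> hS w /asboolP[l [lS ->]]; rewrite linear_sum big_seq big1 // => p /lS pS.
by rewrite linearZ_LR hS ?scaler0.
Qed.

Lemma addsm_kill (A : pzRingType) (V V' : lmodType A) (h : {linear V -> V'})
    (P Q : submodClosed V) : (forall w, w \in P -> h w = 0) ->
    (forall w, w \in Q -> h w = 0) -> forall w, w \in addsm P Q -> h w = 0.
Proof.
move=> hP hQ w /asboolP[p [q [pP qQ ->]]].
by rewrite linearD hP // hQ // addr0.
Qed.

(** * Modules over an enveloping algebra *)

Section EnvelopingModules.
Context (K : comNzRingType) (g : lmodType K) (br : g -> g -> g).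
Local Notation freealg := {malg K[{fmonom g}]}.
Local Notation U := (env br).

Lemma fmonom_cons (x : g) s :
  << FMonom (x :: s) >> = freevar x * << FMonom s >> :> freealg.
Proof.
rewrite /freevar malgM_def fgmulUU mulr1; congr << _ >>.
by apply/val_inj; rewrite /= fmM /fmu fmE.
Qed.

(** Words in the elements of g span U(g). *)
Lemma env_ind (P : U -> Prop) : P 1 ->
    (forall k u v, P u -> P v -> P (k *: u + v)) ->
    (forall x u, P u -> P (env_inj br x * u)) ->
  forall u, P u.
Proof.
move=> P1 Plin Pinj.
have P0 : P 0 by rewrite -(subrr 1) addrC -scaleN1r; apply: Plin.
move=> u; rewrite -[u]reprK; move: (repr u) => {}u.
rewrite [u]monalgE.
apply: (big_ind (fun r => P (\pi_U r))).
- by rewrite (_ : \pi_U 0 = 0) //; apply: (addrI (\pi_U 0)); rewrite -env_piD !addr0.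
- by move=> x y Px Py; rewrite env_piD -[\pi_U x]scale1r; apply: Plin.
move=> m _; set c := u@_m.
have -> : << c *g m >> = c *: << m >> :> freealg.
  by rewrite -mul_malgC malgM_def fgmulUU mulr1 mul1m.
rewrite env_piZ -[env_scale _ _]addr0; apply: Plin => //.
case: m {c} => s; elim: s => [|x s IH].
  rewrite (_ : << _ >> = 1) //; congr << _ >>; apply/val_inj; exact/esym/fm1.
by rewrite fmonom_cons env_piM; apply: Pinj.
Qed.

Record lierep (V : lmodType K) := LieRep {
  rep :> g -> V -> V;
  repPl : forall v k x y, rep (k *: x + y) v = k *: rep x v + rep y v;
  repPr : forall x k v w, rep x (k *: v + w) = k *: rep x v + rep x w;
  rep_br : forall x y v, rep (br x y) v = rep x (rep y v) - rep y (rep x v)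
}.

(** A copy of V that remembers rho, so that the U(g)-module structure put on it
    below can depend on rho. *)
Definition repmod (V : lmodType K) (rho : lierep V) : Type := V.

Arguments repmod {V} rho.

Section RepMod.
Context (V : lmodType K) (rho : lierep V).

Definition word_act (s : seq g) (v : V) : V := foldr rho v s.

Definition free_act (r : freealg) (v : V) : V :=
  \sum_(m <- finmap.enum_fset (msupp r)) r@_m *: word_act m v.

Lemma free_actEw (d : finmap.finset_of (Phant {fmonom g})) r v : finmap.fsubset (msupp r) d ->
  free_act r v = \sum_(m <- finmap.enum_fset d) r@_m *: word_act m v.
Proof.
move=> le; rewrite /free_act (finmap.big_fset_incl _ le) //=.
by move=> x xd /mcoeff_outdom ->; rewrite scale0r.
Qed.

Lemma free_actPl k r s v : free_act (k *: r + s) v = k *: free_act r v + free_act s v.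
Proof.
pose d := finmap.fsetU (msupp r) (msupp s).
have dr : finmap.fsubset (msupp r) d by apply: finmap.fsubsetUl.
have ds : finmap.fsubset (msupp s) d by apply: finmap.fsubsetUr.
have dk : finmap.fsubset (msupp (k *: r + s)) d.
  apply: finmap.fsubset_trans (msuppD_le _ _) _.
  by apply: finmap.fsetUSS; [apply: msuppZ_le|apply: finmap.fsubset_refl].
rewrite (free_actEw _ dr) (free_actEw _ ds) (free_actEw _ dk).
rewrite scaler_sumr -big_split; apply: eq_bigr => m _ /=.
by rewrite mcoeffD mcoeffZ scalerDl scalerA.
Qed.

Lemma free_actU c m v : free_act << c *g m >> v = c *: word_act m v.
Proof.
by rewrite (free_actEw _ msuppU_le) finmap.big_seq_fset1 mcoeffUU.
Qed.

Lemma word_actP s k v w : word_act s (k *: v + w) = k *: word_act s v + word_act s w.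
Proof. by elim: s => //= x s ->; rewrite repPr. Qed.

Lemma free_actPr r k v w : free_act r (k *: v + w) = k *: free_act r v + free_act r w.
Proof.
rewrite /free_act scaler_sumr -big_split; apply: eq_bigr => m _ /=.
by rewrite word_actP scalerDr !scalerA mulrC.
Qed.

Lemma free_act0l v : free_act 0 v = 0.
Proof. by rewrite /free_act msupp0 big_nil. Qed.

Lemma free_act0r r : free_act r 0 = 0.
Proof.
by have := free_actPr r (-1) 0 0; rewrite scaler0 addr0 scaleN1r addNr.
Qed.

Lemma free_actDl r s v : free_act (r + s) v = free_act r v + free_act s v.
Proof. by rewrite -[r]scale1r free_actPl !scale1r. Qed.

Lemma free_actDr r v w : free_act r (v + w) = free_act r v + free_act r w.
Proof. by rewrite -[v]scale1r free_actPr !scale1r. Qed.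

Lemma free_actNl r v : free_act (- r) v = - free_act r v.
Proof. by rewrite -[- r]addr0 -[- r]scaleN1r free_actPl free_act0l addr0 scaleN1r. Qed.

Lemma free_actZl k r v : free_act (k *: r) v = k *: free_act r v.
Proof. by rewrite -[k *: r]addr0 free_actPl free_act0l addr0. Qed.

Lemma free_actM r s v : free_act (r * s) v = free_act r (free_act s v).
Proof.
rewrite malgME.
rewrite (big_morph (free_act^~ v) (fun x y => free_actDl x y v) (free_act0l v)).
rewrite [RHS]/free_act; apply: eq_bigr => m _.
rewrite (big_morph (free_act^~ v) (fun x y => free_actDl x y v) (free_act0l v)).
have wD : {morph word_act m : x y / x + y}.
  by move=> x y; rewrite -[x]scale1r word_actP !scale1r.
have w0 : word_act m 0 = 0.
  by have := word_actP m (-1) 0 0; rewrite scaler0 addr0 scaleN1r addNr.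
rewrite [in RHS]/free_act (big_morph _ wD w0) scaler_sumr; apply: eq_bigr => m' _.
rewrite free_actU -[s@_m' *: _]addr0 word_actP w0 addr0 scalerA; congr (_ *: _).
by rewrite /word_act fmM foldr_cat.
Qed.

Lemma free_act_var x v : free_act (freevar x) v = rho x v.
Proof. by rewrite /freevar free_actU scale1r /word_act /fmu fmE. Qed.

(** The relations defining U(g) say that g acts linearly and that brackets act as
    commutators, which are the axioms of a representation. *)
Lemma free_act_ideal r v : r \in env_ideal br -> free_act r v = 0.
Proof.
move=> /asboolP[l [Hl ->]].
rewrite (big_morph (free_act^~ v) (fun x y => free_actDl x y v) (free_act0l v)).
rewrite big_seq big1 // => p /Hl Hp; rewrite !free_actM.
move: (free_act p.2 v) => w; suff -> : free_act p.1.2 w = 0 by rewrite free_act0r.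
case: Hp => [[k [x [y ->]]]|[x [y ->]]].
  by rewrite free_actDl free_actNl free_actPl !free_act_var repPl subrr.
rewrite free_actDl free_actNl free_actDl free_actNl 2!free_actM !free_act_var.
by rewrite rep_br subrr.
Qed.

HB.instance Definition _ := GRing.Zmodule.copy (repmod rho) V.

Definition env_act (u : U) (v : repmod rho) : repmod rho := free_act (repr u) v.

Lemma env_act_pi r v : env_act (\pi_U r) v = free_act r v.
Proof.
apply/eqP; rewrite -subr_eq0 -free_actNl -free_actDl; apply/eqP.
by apply: free_act_ideal; rewrite -env_piB reprK.
Qed.

Lemma env_actA u w v : env_act u (env_act w v) = env_act (u * w) v.
Proof.
rewrite -[u]reprK -[w]reprK.
have -> : \pi_U (repr u) * \pi_U (repr w) = \pi_U (repr u * repr w).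
  by rewrite env_piM.
by rewrite !env_act_pi free_actM.
Qed.

Lemma env_act1 : left_id 1 env_act.
Proof. by move=> v; rewrite env_act_pi free_actU scale1r /word_act fm1. Qed.

Lemma env_actDr : right_distributive env_act +%R.
Proof. by move=> u v w; apply: free_actDr. Qed.

Lemma env_actDl v : {morph env_act^~ v : u w / u + w}.
Proof.
by move=> u w; rewrite -[u]reprK -[w]reprK -env_piD !env_act_pi free_actDl.
Qed.

HB.instance Definition _ := GRing.Zmodule_isLmodule.Build U (repmod rho)
  env_actA env_act1 env_actDr env_actDl.

Lemma repmod_inj x (v : repmod rho) : env_inj br x *: v = rho x v.
Proof. by rewrite /GRing.scale /= /env_inj env_act_pi free_act_var. Qed.

Lemma repmod_alg k (v : repmod rho) : (k%:A : U) *: v = (k *: (v : V) : V).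
Proof.
rewrite [k%:A](_ : _ = \pi_U (k *: 1)); last by rewrite env_piZ.
by rewrite {1}/GRing.scale /= env_act_pi free_actZl free_actU scale1r /word_act fm1.
Qed.

End RepMod.
End EnvelopingModules.

Arguments repmod {K g br V} rho.

(** * Two parabolic Verma modules, on functions on a lattice *)

Lemma ord4P (P : 'I_4 -> Prop) : P i0 -> P i1 -> P i2 -> P i3 -> forall i, P i.
Proof.
by move=> P0 P1 P2 P3 [[|[|[|[|//]]]] lt4]; rewrite (bool_irrelevance lt4 isT).
Qed.

Lemma ord3P (P : 'I_3 -> Prop) : P node1 -> P node2 -> P node3 -> forall i, P i.
Proof.
by move=> P1 P2 P3 [[|[|[|//]]] lt3]; rewrite (bool_irrelevance lt3 isT).
Qed.

Local Notation lattice := 'rV[int]_4.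

Definition shift (m : lattice) (i j : 'I_4) : lattice :=
  m - delta_mx 0 i + delta_mx 0 j.

Lemma shiftE m i j k : shift m i j 0 k = m 0 k - (k == i)%:R + (k == j)%:R.
Proof. by rewrite !mxE !eqxx. Qed.

Lemma shiftK m i j : shift (shift m i j) j i = m.
Proof. by rewrite /shift addrK subrK. Qed.

(** The exponents of the Laurent monomials of degree 0 in which only the p-th
    variable may occur with a negative exponent. *)
Definition cone (p : 'I_4) (m : lattice) : bool :=
  (\sum_j m 0 j == 0) && [forall j, (j != p) ==> (0 <= m 0 j)].

Lemma sum_shift m i j : \sum_k shift m i j 0 k = \sum_k m 0 k.
Proof.
under eq_bigr => k _ do rewrite shiftE.
rewrite !big_split /= sumrN.
have d1 (l : 'I_4) : \sum_(k < 4) (k == l)%:R = 1 :> int.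
  by rewrite (bigD1 l) //= eqxx big1 ?addr0 // => k /negbTE ->.
by rewrite !d1 subrK.
Qed.

(** A step that lowers a nonnegative coordinate leaves the cone only from the value
    0, where the coefficient m_i of gl_act below vanishes. *)
Lemma cone_shift p m i j : cone p m -> m 0 i != 0 -> cone p (shift m i j).
Proof.
move=> /andP[sm /forallP pm] mi; apply/andP; split; first by rewrite sum_shift.
apply/forallP => k; apply/implyP => kp; have /implyP/(_ kp) := pm k.
rewrite shiftE; case: eqVneq => [->|_]; case: eqVneq => _; move: mi; lia.
Qed.

Definition triple : Type := nat * nat * nat.

(** Normal monomials. The triple (0, 0, k + 1) stands for z^k d a and not for
    z^(k+1): on the highest weight vector z = - (d a + b c), and the two summands
    belong to different families of basis vectors. *)
Definition nmon (A : pzRingType) (a b d z : A) (t : triple) : A :=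
  if (t.1 == (0, 0)%N) && (t.2 != 0)%N then z ^+ t.2.-1 * d * a
  else z ^+ t.2 * a ^+ t.1.1 * b ^+ t.1.2.

Section Scalars.
Context (K : fieldType).

Definition scal (k : K) : Usl4 K := k%:A.

Lemma scal_mull k x : scal k * x = k *: x.
Proof. exact: mulr_algl. Qed.
Lemma scal_mulr k x : x * scal k = scal k * x.
Proof. by rewrite /scal mulr_algl mulr_algr. Qed.
Lemma scal1 : scal 1 = 1.
Proof. exact: scale1r. Qed.
Lemma scalN k : scal (- k) = - scal k.
Proof. exact: scaleNr. Qed.

Lemma scal_comm (M : lmodType (Usl4 K)) (x : Usl4 K) k (w : M) :
  x *: (scal k *: w) = scal k *: (x *: w).
Proof. by rewrite !scalerA scal_mulr. Qed.

Lemma scal_repmod (V : lmodType K) (rho : lierep (@sl4_br K) V) k (v : repmod rho) :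
  scal k *: v = (k *: (v : V) : V).
Proof. exact: repmod_alg. Qed.

Lemma wt_spaceE (M : lmodType (Usl4 K)) mu (v : M) :
  wt_space mu v <-> forall k, U_inj (sl4_h K k) *: v = scal (mu 0 k) *: v.
Proof. by []. Qed.

Lemma wt_space0 (N : lmodType (Usl4 K)) mu : wt_space mu (0 : N).
Proof. by apply/wt_spaceE => k; rewrite !scaler0. Qed.

Lemma wt_spaceP (N : lmodType (Usl4 K)) mu k (x y : N) :
  wt_space mu x -> wt_space mu y -> wt_space mu (scal k *: x + y).
Proof.
move=> /wt_spaceE wx /wt_spaceE wy; apply/wt_spaceE => l.
rewrite [LHS]scalerDr [RHS]scalerDr (wy l).
congr (_ + _).
rewrite [LHS]scal_comm (wx l).
by rewrite [RHS]scal_comm.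
Qed.

Lemma wt_space_linear (V1 V2 : lmodType (Usl4 K)) (h : {linear V1 -> V2}) mu v :
  wt_space mu v -> wt_space mu (h v).
Proof. by move=> wv k; rewrite -linearZ_LR wv linearZ_LR. Qed.

End Scalars.

Section Model.
Context (K : numFieldType).
Local Notation V := (lattice -> K^o).

(** A function on the lattice is a linear form on the Laurent monomials x^m, and
    E_ij acts on forms as the transpose of x_j d/dx_i. Only the monomials with
    exponents in the cone are kept; by cone_shift this is compatible with
    composition. *)
Definition gl_act (p : 'I_4) (A : 'M[K]_4) (f : V) : V := fun m =>
  if cone p m
  then \sum_(x : 'I_4 * 'I_4) A x.1 x.2 * (m 0 x.1)%:~R * f (shift m x.1 x.2)
  else 0.

Lemma gl_actPl p k A B f :
  gl_act p (k *: A + B) f = k *: gl_act p A f + gl_act p B f.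
Proof.
apply/funext => m; rewrite /gl_act -[RHS]/(k * _ + _); case: ifP => _; last first.
  by rewrite mulr0 addr0.
rewrite mulr_sumr -big_split; apply: eq_bigr => x _ /=.
by rewrite !mxE; ring.
Qed.

Lemma gl_actPr p A k f g :
  gl_act p A (k *: f + g) = k *: gl_act p A f + gl_act p A g.
Proof.
apply/funext => m; rewrite /gl_act -[RHS]/(k * _ + _); case: ifP => _; last first.
  by rewrite mulr0 addr0.
rewrite mulr_sumr -big_split; apply: eq_bigr => x _ /=.
rewrite -[(k *: f + g) _]/(k * f _ + g _); ring.
Qed.

(** The second sum is symmetric in A and B and drops out of the commutator. *)
Lemma gl_actM p A B f m : cone p m ->
  gl_act p A (gl_act p B f) m = gl_act p (A *m B) f m +
    \sum_x \sum_y A x.1 x.2 * B y.1 y.2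
      * (m 0 x.1 * (m 0 y.1 - (y.1 == x.1)%:R))%:~R
      * f (shift (shift m x.1 x.2) y.1 y.2).
Proof.
move=> cm; rewrite /gl_act cm.
transitivity (\sum_x \sum_y A x.1 x.2 * B y.1 y.2
      * (m 0 x.1 * shift m x.1 x.2 0 y.1)%:~R
      * f (shift (shift m x.1 x.2) y.1 y.2)).
  apply: eq_bigr => x _; case: (eqVneq (m 0 x.1) 0) => [->|mx].
    rewrite mulr0 mul0r big1 // => y _; by rewrite mul0r mulr0 mul0r.
  rewrite (cone_shift _ cm mx) mulr_sumr; apply: eq_bigr => y _.
  rewrite intrM; ring.
transitivity (\sum_(x : 'I_4 * 'I_4) \sum_(y : 'I_4 * 'I_4)
      (A x.1 x.2 * B y.1 y.2 * (m 0 x.1)%:~R * f (shift m x.1 y.2)) *+ (y.1 == x.2)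
   + \sum_x \sum_y A x.1 x.2 * B y.1 y.2
      * (m 0 x.1 * (m 0 y.1 - (y.1 == x.1)%:R))%:~R
      * f (shift (shift m x.1 x.2) y.1 y.2)).
  rewrite -big_split; apply: eq_bigr => x _; rewrite -big_split.
  apply: eq_bigr => y _ /=; rewrite shiftE.
  rewrite -mulrnAr.
  have -> : f (shift m x.1 y.2) *+ (y.1 == x.2)
    = f (shift (shift m x.1 x.2) y.1 y.2) *+ (y.1 == x.2).
    by case: eqVneq => [->|_]; rewrite ?mulr0n //= !mulr1n /shift addrK.
  by case: (y.1 == x.1); case: (y.1 == x.2); rewrite ?mulr1n ?mulr0n; ring.
congr (_ + _).
rewrite -(pair_bigA _ (fun i j => \sum_(y : 'I_4 * 'I_4)
  (A i j * B y.1 y.2 * (m 0 i)%:~R * f (shift m i y.2)) *+ (y.1 == j))) /=.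
rewrite -(pair_bigA _ (fun i l => (A *m B) i l * (m 0 i)%:~R * f (shift m i l))) /=.
apply: eq_bigr => i _.
under eq_bigr => j _ do rewrite -(pair_bigA _ (fun k l =>
  (A i j * B k l * (m 0 i)%:~R * f (shift m i l)) *+ (k == j))) exchange_big /=.
rewrite exchange_big; apply: eq_bigr => l _ /=.
rewrite mxE !mulr_suml; apply: eq_bigr => j _.
rewrite (bigD1 j) //= eqxx mulr1n big1 ?addr0 // => k /negbTE ->.
by rewrite mulr0n.
Qed.

Lemma gl_act_br p A B f : gl_act p (A *m B - B *m A) f =
  gl_act p A (gl_act p B f) - gl_act p B (gl_act p A f).
Proof.
apply/funext => m; rewrite -[RHS]/(_ + - _).
case cm : (cone p m); last by rewrite /gl_act cm subr0.
have -> : gl_act p (A *m B - B *m A) f m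
    = gl_act p (A *m B) f m - gl_act p (B *m A) f m.
  have -> : A *m B - B *m A = (-1) *: (B *m A) + A *m B by rewrite scaleN1r addrC.
  by rewrite gl_actPl -[LHS]/(-1 * _ + _) mulN1r addrC.
rewrite !gl_actM //; set S1 := (X in _ + X - _); set S2 := (X in - (_ + X)).
suff -> : S1 = S2 by ring.
rewrite /S1 exchange_big; apply: eq_bigr => y _; apply: eq_bigr => x _ /=.
have -> : shift (shift m x.1 x.2) y.1 y.2 = shift (shift m y.1 y.2) x.1 x.2.
  by apply/rowP => k; rewrite !shiftE; ring.
rewrite [A _ _ * _]mulrC; congr (_ * _%:~R * _).
case: (eqVneq x.1 y.1) => [->|_] //=.
by rewrite !subr0 mulrC.
Qed.

Lemma gl_act_delta p i j f m :
  gl_act p (delta_mx i j) f m = if cone p m then (m 0 i)%:~R * f (shift m i j) else 0.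
Proof.
rewrite /gl_act; case: ifP => // _; rewrite (bigD1 (i, j)) //= big1.
  by rewrite mxE !eqxx mul1r addr0.
case=> k l /=; rewrite mxE xpair_eqE => /negbTE ->; by rewrite !mul0r.
Qed.

Lemma gl_act_diag p i f m :
  gl_act p (delta_mx i i) f m = if cone p m then (m 0 i)%:~R * f m else 0.
Proof. by rewrite gl_act_delta /shift subrK. Qed.

Lemma gl_actN p A f : gl_act p (- A) f = - gl_act p A f.
Proof.
apply/funext => m; rewrite -[RHS]/(- _) /gl_act; case: ifP; last by rewrite oppr0.
by move=> _; rewrite -sumrN; apply: eq_bigr => x _; rewrite mxE !mulNr.
Qed.

Definition dirac (m : lattice) : V := fun m' => (m' == m)%:R.

(** The generators of n^- move Dirac functions to multiples of Dirac functions; all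
    that matters about the multiple is that it is not zero. *)
Definition nz_dirac (f : V) (m : lattice) :=
  exists2 c : K, c != 0 & f = c *: dirac m.

Lemma nz_diracN f m : nz_dirac f m -> nz_dirac (- f) m.
Proof. by case=> c c0 ->; exists (- c); rewrite ?oppr_eq0 // scaleNr. Qed.

Lemma gl_act_nz_dirac p i j f m : nz_dirac f m -> cone p (shift m j i) ->
  shift m j i 0 i != 0 -> nz_dirac (gl_act p (delta_mx i j) f) (shift m j i).
Proof.
case=> c c0 -> cm mi; exists ((shift m j i 0 i)%:~R * c).
  by rewrite mulf_neq0 // intr_eq0.
apply/funext => m'; rewrite gl_act_delta.
rewrite -[RHS]/(_ * c * _) -[(c *: dirac m) _]/(c * _) /dirac.
have -> : (shift m' i j == m) = (m' == shift m j i).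
  by apply/eqP/eqP => [<-|->]; rewrite shiftK.
case: eqP => [->|_]; first by rewrite cm mulrA.
by rewrite !mulr0; case: ifP.
Qed.

(** A nonzero contribution of A_ij at m means m = e_i - e_j; if i and j differ then
    m_j = -1, which the cone allows only for j = p. *)
Lemma gl_act_dirac0 p (A : 'M_4) : (forall i, i != p -> A i p = 0) ->
  gl_act p A (dirac 0) = 0.
Proof.
move=> Ap; apply/funext => m; rewrite /gl_act -[RHS]/0.
case: ifP => // /andP[_ /forallP cm]; apply: big1 => -[i j] _ /=.
rewrite /dirac; case: eqP => [e|_]; last by rewrite mulr0.
have mE : m = shift 0 j i by rewrite -e shiftK.
case: (eqVneq i j) => [ij|ij].
  by rewrite mE ij shiftE mxE subrK mulr0 mul0r.
case: (eqVneq j p) => [jp|jp]; first by rewrite jp Ap -?jp ?mul0r.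
have := cm j; rewrite jp /= mE shiftE mxE eqxx eq_sym (negbTE ij) //.
Qed.

Lemma gl_act_cone0 p A (f g : V) : (forall m, cone p m -> f m = g m) ->
  gl_act p A f = gl_act p A g.
Proof.
move=> fg; apply/funext => m; rewrite /gl_act; case: ifP => // cm.
apply: eq_bigr => x _; case: (eqVneq (m 0 x.1) 0) => [->|mx].
  by rewrite mulr0 !mul0r.
by rewrite (fg _ (cone_shift _ cm mx)).
Qed.

Lemma sl4_actPl p (f : V) k (x y : sl4 K) :
  gl_act p (k *: x + y : sl4 K) f = k *: gl_act p x f + gl_act p y f.
Proof. exact: gl_actPl. Qed.

Lemma sl4_act_br p (x y : sl4 K) f : gl_act p (sl4_br x y) f =
  gl_act p x (gl_act p y f) - gl_act p y (gl_act p x f).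
Proof. exact: gl_act_br. Qed.

(** A completion of M(0) / (f_2, f_3), the parabolic Verma module in which E_10,
    E_20 and E_30 act freely. *)
Definition rep1 : lierep (@sl4_br K) V :=
  LieRep (sl4_actPl i0) (fun x => gl_actPr i0 x) (sl4_act_br i0).

Lemma sl4_dual_actPl p (f : V) k (x y : sl4 K) :
  gl_act p (- (k *: x + y : sl4 K)^T) f =
  k *: gl_act p (- x^T) f + gl_act p (- y^T) f.
Proof.
rewrite -gl_actPl; congr gl_act.
by apply/matrixP => i j; rewrite !mxE; ring.
Qed.

Lemma sl4_dual_act_br p (x y : sl4 K) f : gl_act p (- (sl4_br x y)^T) f =
  gl_act p (- x^T) (gl_act p (- y^T) f) - gl_act p (- y^T) (gl_act p (- x^T) f).
Proof.
rewrite -gl_act_br; congr gl_act.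
by rewrite linearB /= !trmx_mul !mulmxN !mulNmx !opprK opprB.
Qed.

(** A completion of M(0) / (f_1, f_2), in which E_30, E_31 and E_32 act freely:
    the construction of rep1 twisted by the automorphism x |-> - x^T. *)
Definition rep2 : lierep (@sl4_br K) V :=
  LieRep (sl4_dual_actPl i3) (fun x => gl_actPr i3 (- (x : sl4 K)^T)) (sl4_dual_act_br i3).

Lemma sl4_E_subproof (i j : 'I_4) :
  {x : sl4 K | i != j -> x = delta_mx i j :> 'M[K]_4}.
Proof.
have [ij|ij] := boolP (i != j); last by exists 0.
suff tr : delta_mx i j \in @trace0 K by exists (Sl4 tr).
apply/eqP; rewrite /mxtrace big1 // => k _; rewrite mxE.
by case: eqP => //= ->; rewrite (negbTE ij).
Qed.

(** The elementary matrices are taken from an opaque proof, so that comparing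
    elements of U(sl4) never computes with matrices. *)
Definition sl4_E (i j : 'I_4) : sl4 K := sval (sl4_E_subproof i j).

Lemma sl4_EE i j : i != j -> sl4_E i j = delta_mx i j :> 'M[K]_4.
Proof. exact: svalP (sl4_E_subproof i j). Qed.

(** The lattice points reached in rep1 and rep2 by the normal monomials; the entry
    with the negative sign is forced by degree 0. *)
Definition pos1 (t : triple) : lattice := \row_l
  nth 0 [:: - (t.1.1 + t.1.2 + t.2)%N%:Z; t.1.1%:Z; t.1.2%:Z; t.2%:Z] l.
Definition pos2 (t : triple) : lattice := \row_l
  nth 0 [:: t.2%:Z; t.1.2%:Z; t.1.1%:Z; - (t.1.1 + t.1.2 + t.2)%N%:Z] l.

Lemma cone_pos1 t : cone i0 (pos1 t).
Proof.
apply/andP; split; first by rewrite !big_ord_recl big_ord0 !mxE /=; apply/eqP; lia.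
by apply/forallP; elim/ord4P; rewrite !mxE //=; lia.
Qed.

Lemma cone_pos2 t : cone i3 (pos2 t).
Proof.
apply/andP; split; first by rewrite !big_ord_recl big_ord0 !mxE /=; apply/eqP; lia.
by apply/forallP; elim/ord4P; rewrite !mxE //=; lia.
Qed.

Lemma pos1_inj : injective pos1.
Proof.
move=> [[i j] k] [[i' j'] k'] e; have E l := congr1 (fun m : lattice => m 0 l) e.
have := E i1; have := E i2; have := E i3; rewrite !mxE /=.
by move=> [->] [->] [->].
Qed.

Lemma pos2_inj : injective pos2.
Proof.
move=> [[i j] k] [[i' j'] k'] e; have E l := congr1 (fun m : lattice => m 0 l) e.
have := E i0; have := E i1; have := E i2; rewrite !mxE /=.
by move=> [->] [->] [->].
Qed.

Lemma pos1_0 : pos1 (0, 0, 0)%N = 0.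
Proof. by apply/rowP; elim/ord4P; rewrite !mxE. Qed.

Lemma pos2_0 : pos2 (0, 0, 0)%N = 0.
Proof. by apply/rowP; elim/ord4P; rewrite !mxE. Qed.

Local Notation U := (Usl4 K).
Local Notation XE i j := (U_inj (sl4_E i j) : U).

Definition U_a : U := XE i1 i0.
Definition U_b : U := XE i2 i0.
Definition U_c : U := XE i3 i2.
(** The sign makes this [f_2, f_3]. *)
Definition U_d : U := - XE i3 i1.
Definition U_z : U := XE i3 i0.
Definition U_f : U := XE i2 i1.

Lemma rep1E (i j : 'I_4) (v : repmod rep1) : i != j ->
  XE i j *: v = gl_act i0 (delta_mx i j) v.
Proof. by move=> ij; rewrite repmod_inj /= sl4_EE. Qed.

Lemma rep2E (i j : 'I_4) (v : repmod rep2) : i != j ->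
  XE i j *: v = - gl_act i3 (delta_mx j i) v.
Proof. by move=> ij; rewrite repmod_inj /= sl4_EE // gl_actN trmx_delta. Qed.

Lemma U_a_pos1 i j k (v : repmod rep1) : nz_dirac v (pos1 (i, j, k)) ->
  nz_dirac (U_a *: v) (pos1 (i.+1, j, k)).
Proof.
move=> nzv; rewrite rep1E //.
have e : pos1 (i.+1, j, k) = shift (pos1 (i, j, k)) i0 i1.
  by apply/rowP; elim/ord4P; rewrite shiftE !mxE /=; lia.
by rewrite e; apply: gl_act_nz_dirac => //; rewrite -e ?cone_pos1 // mxE.
Qed.

Lemma U_b_pos1 i j k (v : repmod rep1) : nz_dirac v (pos1 (i, j, k)) ->
  nz_dirac (U_b *: v) (pos1 (i, j.+1, k)).
Proof.
move=> nzv; rewrite rep1E //.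
have e : pos1 (i, j.+1, k) = shift (pos1 (i, j, k)) i0 i2.
  by apply/rowP; elim/ord4P; rewrite shiftE !mxE /=; lia.
by rewrite e; apply: gl_act_nz_dirac => //; rewrite -e ?cone_pos1 // mxE.
Qed.

Lemma U_z_pos1 i j k (v : repmod rep1) : nz_dirac v (pos1 (i, j, k)) ->
  nz_dirac (U_z *: v) (pos1 (i, j, k.+1)).
Proof.
move=> nzv; rewrite rep1E //.
have e : pos1 (i, j, k.+1) = shift (pos1 (i, j, k)) i0 i3.
  by apply/rowP; elim/ord4P; rewrite shiftE !mxE /=; lia.
by rewrite e; apply: gl_act_nz_dirac => //; rewrite -e ?cone_pos1 // mxE.
Qed.

Lemma U_d_pos1 i j k (v : repmod rep1) : nz_dirac v (pos1 (i.+1, j, k)) ->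
  nz_dirac (U_d *: v) (pos1 (i, j, k.+1)).
Proof.
move=> nzv; rewrite scaleNr; apply: nz_diracN; rewrite rep1E //.
have e : pos1 (i, j, k.+1) = shift (pos1 (i.+1, j, k)) i1 i3.
  by apply/rowP; elim/ord4P; rewrite shiftE !mxE /=; lia.
by rewrite e; apply: gl_act_nz_dirac => //; rewrite -e ?cone_pos1 // mxE.
Qed.

Lemma U_c_pos2 i j k (v : repmod rep2) : nz_dirac v (pos2 (i, j, k)) ->
  nz_dirac (U_c *: v) (pos2 (i.+1, j, k)).
Proof.
move=> nzv; rewrite rep2E //; apply: nz_diracN.
have e : pos2 (i.+1, j, k) = shift (pos2 (i, j, k)) i3 i2.
  by apply/rowP; elim/ord4P; rewrite shiftE !mxE /=; lia.
by rewrite e; apply: gl_act_nz_dirac => //; rewrite -e ?cone_pos2 // mxE.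
Qed.

Lemma U_d_pos2 i j k (v : repmod rep2) : nz_dirac v (pos2 (i, j, k)) ->
  nz_dirac (U_d *: v) (pos2 (i, j.+1, k)).
Proof.
move=> nzv; rewrite scaleNr rep2E // opprK.
have e : pos2 (i, j.+1, k) = shift (pos2 (i, j, k)) i3 i1.
  by apply/rowP; elim/ord4P; rewrite shiftE !mxE /=; lia.
by rewrite e; apply: gl_act_nz_dirac => //; rewrite -e ?cone_pos2 // mxE.
Qed.

Lemma U_z_pos2 i j k (v : repmod rep2) : nz_dirac v (pos2 (i, j, k)) ->
  nz_dirac (U_z *: v) (pos2 (i, j, k.+1)).
Proof.
move=> nzv; rewrite rep2E //; apply: nz_diracN.
have e : pos2 (i, j, k.+1) = shift (pos2 (i, j, k)) i3 i0.
  by apply/rowP; elim/ord4P; rewrite shiftE !mxE /=; lia.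
by rewrite e; apply: gl_act_nz_dirac => //; rewrite -e ?cone_pos2 // mxE.
Qed.

Lemma U_b_pos2 i j k (v : repmod rep2) : nz_dirac v (pos2 (i.+1, j, k)) ->
  nz_dirac (U_b *: v) (pos2 (i, j, k.+1)).
Proof.
move=> nzv; rewrite rep2E //; apply: nz_diracN.
have e : pos2 (i, j, k.+1) = shift (pos2 (i.+1, j, k)) i2 i0.
  by apply/rowP; elim/ord4P; rewrite shiftE !mxE /=; lia.
by rewrite e; apply: gl_act_nz_dirac => //; rewrite -e ?cone_pos2 // mxE.
Qed.

(** The last hypothesis accounts for the factor d a, which reaches (0, 0, k + 1)
    through (1, 0, k). *)
Lemma nmon_ind (M : lmodType U) (a b d z : U) (v : M) (Q : triple -> M -> Prop) :
    (forall i j k w, Q (i, j, k) w -> Q (i.+1, j, k) (a *: w)) ->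
    (forall i j k w, Q (i, j, k) w -> Q (i, j.+1, k) (b *: w)) ->
    (forall i j k w, Q (i, j, k) w -> Q (i, j, k.+1) (z *: w)) ->
    (forall i j k w, Q (i.+1, j, k) w -> Q (i, j, k.+1) (d *: w)) ->
    Q (0, 0, 0)%N v -> forall t, Q t (nmon a b d z t *: v).
Proof.
move=> Qa Qb Qz Qd Qv.
have Qzn n i j k w : Q (i, j, k) w -> Q (i, j, k + n)%N (z ^+ n *: w).
  elim: n k => [|n IH] k Qw; first by rewrite addn0 expr0 scale1r.
  by rewrite addnS exprS -scalerA; apply: Qz; apply: IH.
case=> [[i j] k]; rewrite /nmon /=; case: ifP => [/andP[/eqP[-> ->]]|_].
  case: k => // k _; rewrite -!scalerA /= -addn1 addnC.
  by apply: Qzn; apply: Qd; apply: Qa.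
rewrite -!scalerA -[k in Q (_, _, k)]add0n; apply: Qzn.
elim: i => [|i IH]; last by rewrite exprS -scalerA; apply: Qa.
rewrite expr0 scale1r; elim: j => [|j IH]; last by rewrite exprS -scalerA; apply: Qb.
by rewrite expr0 scale1r.
Qed.

Lemma nmon_kill (M : lmodType U) (a b d z : U) (v : M) : a *: v = 0 ->
  b *: v = 0 -> forall t, t != (0, 0, 0)%N -> nmon a b d z t *: v = 0.
Proof.
move=> av bv [[i j] k]; rewrite /nmon /= => t0.
case: ifP => [_|]; first by rewrite -scalerA av scaler0.
case: j t0 => [|j] t0; last by rewrite exprSr mulrA -scalerA bv scaler0.
case: i t0 => [|i] t0; last by rewrite expr0 mulr1 exprSr mulrA -scalerA av scaler0.
by case: k t0.
Qed.

Definition vac1 : repmod rep1 := dirac 0.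
Definition vac2 : repmod rep2 := dirac 0.

Lemma nz_dirac0 : nz_dirac (dirac 0) 0.
Proof. by exists 1; rewrite ?oner_eq0 ?scale1r. Qed.

Definition nmonL := nmon U_a U_b U_d U_z.
Definition nmonR := nmon U_c U_d U_b U_z.

Lemma nmonL_vac1 t : nz_dirac (nmonL t *: vac1) (pos1 t).
Proof.
apply: (@nmon_ind (repmod (rep1)) _ _ _ _ _ (fun t v => nz_dirac v (pos1 t))).
- exact: U_a_pos1.
- exact: U_b_pos1.
- exact: U_z_pos1.
- exact: U_d_pos1.
- by rewrite pos1_0; apply: nz_dirac0.
Qed.

Lemma nmonR_vac2 t : nz_dirac (nmonR t *: vac2) (pos2 t).
Proof.
apply: (@nmon_ind (repmod (rep2)) _ _ _ _ _ (fun t v => nz_dirac v (pos2 t))).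
- exact: U_c_pos2.
- exact: U_d_pos2.
- exact: U_z_pos2.
- exact: U_b_pos2.
- by rewrite pos2_0; apply: nz_dirac0.
Qed.

Lemma delta_col0 (i j p : 'I_4) : j != p ->
  forall k, k != p -> (delta_mx i j : 'M[K]_4) k p = 0.
Proof. by move=> jp k _; rewrite mxE [p == j]eq_sym (negbTE jp) andbF. Qed.

Lemma nmonL_vac2 t : t != (0, 0, 0)%N -> nmonL t *: vac2 = 0.
Proof.
by apply: nmon_kill; rewrite rep2E // gl_act_dirac0 ?oppr0 //; apply: delta_col0.
Qed.

Lemma nmonR_vac1 t : t != (0, 0, 0)%N -> nmonR t *: vac1 = 0.
Proof.
by apply: nmon_kill; rewrite ?scaleNr rep1E // gl_act_dirac0 ?oppr0 //;
  apply: delta_col0.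
Qed.

Lemma XE_comm0 i j k l : i != j -> k != l -> j != k -> i != l ->
  XE i j * XE k l = XE k l * XE i j.
Proof.
move=> ij kl jk il; apply/eqP; rewrite -subr_eq0 /U_inj -env_inj_br.
suff -> : sl4_br (sl4_E i j) (sl4_E k l) = 0.
  have := env_inj_linear (@sl4_br K) (-1) 0 0.
  by rewrite scaler0 addr0 scaleN1r addNr => ->.
apply/val_inj; rewrite /= !sl4_EE // !mul_delta_mx_cond (negbTE jk) eq_sym.
by rewrite (negbTE il) !mulr0n subrr.
Qed.

Lemma XE_comm1 i j l : i != j -> j != l -> i != l ->
  XE i j * XE j l = XE j l * XE i j + XE i l.
Proof.
move=> ij jl il; apply/eqP; rewrite addrC -subr_eq /U_inj -env_inj_br; apply/eqP.
congr env_inj; apply/val_inj; rewrite /= !sl4_EE // !mul_delta_mx_cond eqxx.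
by rewrite eq_sym (negbTE il) mulr0n subr0.
Qed.

Lemma U_injE (x : sl4 K) (i j : 'I_4) : i != j ->
  x = delta_mx i j :> 'M[K]_4 -> U_inj x = XE i j.
Proof. by move=> ij xE; congr U_inj; apply/val_inj; rewrite /= sl4_EE. Qed.

Lemma f1E : U_inj (sl4_f K node1) = U_a.
Proof. by apply: U_injE => //=; congr delta_mx; apply/val_inj. Qed.
Lemma f2E : U_inj (sl4_f K node2) = U_f.
Proof. by apply: U_injE => //=; congr delta_mx; apply/val_inj. Qed.
Lemma f3E : U_inj (sl4_f K node3) = U_c.
Proof. by apply: U_injE => //=; congr delta_mx; apply/val_inj. Qed.

Definition hval (m : lattice) (k : 'I_3) : int := m 0 (node_lo k) - m 0 (node_hi k).

Lemma act_h p (k : 'I_3) f m : gl_act p (sl4_h K k) f m =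
  if cone p m then (hval m k)%:~R * f m else 0.
Proof.
rewrite /= -scaleN1r addrC gl_actPl -[LHS]/(-1 * _ + _) !gl_act_diag.
by case: ifP => _; rewrite /hval ?rmorphB /=; ring.
Qed.

Lemma act_dual_h p (k : 'I_3) f m : gl_act p (- (sl4_h K k)^T) f m =
  if cone p m then - (hval m k)%:~R * f m else 0.
Proof.
have -> : (sl4_h K k)^T = sl4_h K k :> 'M_4 by rewrite linearB /= !trmx_delta.
by rewrite gl_actN -[LHS]/(- _) act_h; case: ifP; rewrite ?oppr0 ?mulNr.
Qed.

Definition wt1 t : weight K := \row_k (hval (pos1 t) k)%:~R.
Definition wt2 t : weight K := \row_k - (hval (pos2 t) k)%:~R.

Lemma wt_space1 mu (f : repmod rep1) m : wt_space mu f -> cone i0 m ->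
  f m != 0 -> mu = \row_k (hval m k)%:~R.
Proof.
move=> wf cm fm; apply/rowP => k; rewrite mxE.
have := congr1 (fun g : V => g m) (wf k).
rewrite /= repmod_inj repmod_alg /= act_h cm -[RHS]/(mu 0 k * f m).
by move/(mulIf fm).
Qed.

Lemma wt_space2 mu (f : repmod rep2) m : wt_space mu f -> cone i3 m ->
  f m != 0 -> mu = \row_k - (hval m k)%:~R.
Proof.
move=> wf cm fm; apply/rowP => k; rewrite mxE.
have := congr1 (fun g : V => g m) (wf k).
rewrite /= repmod_inj repmod_alg /= act_dual_h cm -[RHS]/(mu 0 k * f m).
by move/(mulIf fm).
Qed.

Lemma wt_space_dirac1 t (f : repmod rep1) : nz_dirac f (pos1 t) ->
  wt_space (wt1 t) f.
Proof.
case=> c _ -> k; rewrite repmod_inj repmod_alg /= mxE; apply/funext => m.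
rewrite act_h -[RHS]/(_ * _) -[(c *: dirac _) m]/(c * _) /dirac.
case: eqP => [->|_]; first by rewrite cone_pos1.
by rewrite !mulr0; case: ifP.
Qed.

Lemma wt_space_dirac2 t (f : repmod rep2) : nz_dirac f (pos2 t) ->
  wt_space (wt2 t) f.
Proof.
case=> c _ -> k; rewrite repmod_inj repmod_alg /= mxE; apply/funext => m.
rewrite act_dual_h -[RHS]/(_ * _) -[(c *: dirac _) m]/(c * _) /dirac.
case: eqP => [->|_]; first by rewrite cone_pos2.
by rewrite !mulr0; case: ifP.
Qed.

Lemma hval_eq0 (m : lattice) : \sum_j m 0 j = 0 -> (forall k, hval m k = 0) -> m = 0.
Proof.
move=> + hm; move: (hm node1) (hm node2) (hm node3).
rewrite /hval !big_ord_recl big_ord0.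
have -> : node_lo node1 = ord0 by apply/val_inj.
have -> : node_hi node1 = lift ord0 ord0 by apply/val_inj.
have -> : node_lo node2 = lift ord0 ord0 by apply/val_inj.
have -> : node_hi node2 = lift ord0 (lift ord0 ord0) by apply/val_inj.
have -> : node_lo node3 = lift ord0 (lift ord0 ord0) by apply/val_inj.
have -> : node_hi node3 = lift ord0 (lift ord0 (lift ord0 ord0)) by apply/val_inj.
move=> e1 e2 e3 e4; apply/rowP; elim/ord4P; rewrite mxE.
- by rewrite (_ : i0 = ord0); [lia|apply/val_inj].
- by rewrite (_ : i1 = lift ord0 ord0); [lia|apply/val_inj].
- by rewrite (_ : i2 = lift ord0 (lift ord0 ord0)); [lia|apply/val_inj].
- by rewrite (_ : i3 = lift ord0 (lift ord0 (lift ord0 ord0))); [lia|apply/val_inj].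
Qed.

(** By wt0_supp1 and wt0_supp2 below, f may be any vector of weight 0, so such a
    vector acts like a multiple of the highest weight vector. *)
Lemma gl_act_wt0 p A (f : V) : (forall m, cone p m -> f m != 0 -> m = 0) ->
  gl_act p A f = f 0 *: gl_act p A (dirac 0).
Proof.
move=> f0; have <- : gl_act p A (f 0 *: dirac 0) = f 0 *: gl_act p A (dirac 0).
  have := gl_actPr p A (f 0) (dirac 0) 0; rewrite addr0 => ->.
  by have := gl_actPr p A (-1) 0 0; rewrite scaler0 addr0 scaleN1r addNr => ->; rewrite addr0.
apply: gl_act_cone0 => m /f0 fm; rewrite -[RHS]/(_ * _) /dirac.
case: eqP => [->|/eqP m0]; first by rewrite mulr1.
by rewrite mulr0; apply: contraNeq m0 => /fm ->.
Qed.

Lemma wt0_supp1 (f : repmod rep1) m : wt_space 0 f -> cone i0 m -> f m != 0 -> m = 0.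
Proof.
move=> wf cm /(wt_space1 wf cm)/rowP e; apply: hval_eq0 => [|k]; first by case/andP: cm => /eqP.
by have /esym/eqP := e k; rewrite !mxE intr_eq0 => /eqP.
Qed.

Lemma wt0_supp2 (f : repmod rep2) m : wt_space 0 f -> cone i3 m -> f m != 0 -> m = 0.
Proof.
move=> wf cm /(wt_space2 wf cm)/rowP e; apply: hval_eq0 => [|k]; first by case/andP: cm => /eqP.
by have /esym/eqP := e k; rewrite !mxE oppr_eq0 intr_eq0 => /eqP.
Qed.

Lemma sl4_h_offdiag k (p i : 'I_4) : i != p -> sl4_h K k i p = 0.
Proof.
move=> ip; have d0 (l : 'I_4) : (i == l) && (p == l) = false.
  by apply/negP => /andP[/eqP il /eqP pl]; move: ip; rewrite il pl eqxx.
by rewrite !mxE !d0 subr0.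
Qed.

(** What the image of the highest weight vector of MM has to satisfy. The whole
    weight space of weight 0 enters because it generates the submodules that are
    divided out. *)
Definition null_vac (M : lmodType U) (v : M) :=
  [/\ forall u, verma_gens 0 u -> (u : U) *: v = 0,
      forall m, wt_space 0 m -> U_a * U_c *: (m : M) = 0 &
      forall m, wt_space 0 m -> U_f *: (m : M) = 0].

Lemma null_vac1 : null_vac vac1.
Proof.
split=> [u|m wm|m wm].
- case=> [[x ux ->]|[k ->]].
    rewrite repmod_inj /= gl_act_dirac0 // => i ip; rewrite ux //.
  rewrite mxE scale0r subr0 repmod_inj; apply: gl_act_dirac0.
  exact: sl4_h_offdiag.
- rewrite -scalerA [U_c *: m]rep1E // (gl_act_wt0 _ (fun m => wt0_supp1 wm)).
  by rewrite gl_act_dirac0 ?scaler0 ?[_ *: 0]scaler0 //; apply: delta_col0.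
- rewrite rep1E // (gl_act_wt0 _ (fun m => wt0_supp1 wm)).
  by rewrite gl_act_dirac0 ?scaler0 //; apply: delta_col0.
Qed.

Lemma null_vac2 : null_vac vac2.
Proof.
split=> [u|m wm|m wm].
- case=> [[x ux ->]|[k ->]].
    rewrite repmod_inj /= gl_act_dirac0 // => i ip.
    by rewrite !mxE ux ?oppr0 // -ltnS; apply: (ltn_ord i).
  rewrite mxE scale0r subr0 repmod_inj; apply: gl_act_dirac0 => i ip.
  by rewrite mxE [_^T _ _]mxE sl4_h_offdiag ?oppr0 // eq_sym.
- rewrite XE_comm0 // -scalerA [_ *: m]rep2E // (gl_act_wt0 _ (fun m => wt0_supp2 wm)).
  by rewrite gl_act_dirac0 ?scaler0 ?oppr0 ?scaler0 //; apply: delta_col0.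
- rewrite rep2E // (gl_act_wt0 _ (fun m => wt0_supp2 wm)).
  by rewrite gl_act_dirac0 ?scaler0 ?oppr0 //; apply: delta_col0.
Qed.

Definition MM_vac : MM K :=
  \pi_(quotmod (addsm (@MM_sub13 K) (@MM_sub2 K)))
    (\pi_(quotmod (submod_span (verma_gens 0))) 1).

Lemma verma_map (M : lmodType U) (v : M) :
    (forall u, verma_gens 0 u -> (u : U) *: v = 0) ->
  exists h : {linear verma 0 -> M},
    h (\pi_(quotmod (submod_span (verma_gens 0))) 1) = v.
Proof.
move=> vgens; pose h0 (u : U^o) : M := u *: v.
have h0lin : linear h0 by move=> a x y; rewrite /h0 scalerDl scalerA.
pose h0' : {linear U^o -> M} := HB.pack h0 (GRing.isLinear.Build U U^o M *:%R h0 h0lin).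
have [h1 h1K] := quotmod_lift (@span_kill _ _ _ h0' _ vgens).
by exists h1; rewrite h1K; apply: scale1r.
Qed.

(** The universal property of MM. *)
Lemma MM_map (M : lmodType U) (v : M) : null_vac v ->
  exists h : {linear MM K -> M}, h MM_vac = v.
Proof.
case=> vgens v13 v2; have [h1 h1K] := verma_map vgens.
have k13 w : w \in @MM_sub13 K -> h1 w = 0.
  apply: span_kill => s [m wm <-]; rewrite linearZ_LR f1E f3E v13 //.
  exact: wt_space_linear.
have k2 w : w \in @MM_sub2 K -> h1 w = 0.
  apply: span_kill => s [m wm <-]; rewrite linearZ_LR f2E v2 //.
  exact: wt_space_linear.
have [h2 h2K] := quotmod_lift (addsm_kill k13 k2).
by exists h2; rewrite /MM_vac h2K h1K.
Qed.

End Model.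

(** * Relations in MM and a spanning family *)

(** The commutation rules of n^- for a = f_1, c = f_3, f = f_2, b = [f, a],
    d = [f, c] and z = [a, d]. *)
Record lower_rels (A : pzRingType) (a b c d z f : A) : Prop := LowerRels {
  rel_fa : f * a = a * f + b; rel_fb : f * b = b * f;
  rel_fc : f * c = c * f + d; rel_fd : f * d = d * f; rel_fz : f * z = z * f;
  rel_ab : a * b = b * a; rel_cd : c * d = d * c;
  rel_ac : a * c = c * a; rel_bd : b * d = d * b;
  rel_ad : a * d = d * a + z; rel_bc : b * c = c * b - z;
  rel_az : a * z = z * a; rel_bz : b * z = z * b;
  rel_cz : c * z = z * c; rel_dz : d * z = z * d }.

Section Lower.
Context (A : pzRingType) (a b c d z f : A).
Context (rels : lower_rels a b c d z f).

(** The symmetry of the Dynkin diagram. It exchanges the two families of basis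
    vectors, so that every computation below is done for one of them only. *)
Lemma lower_rels_swap : lower_rels c d a b z f.
Proof.
case: rels => fa fb fc fd fz ab cd ac bd ad bc az bz cz dz; split=> //.
- by rewrite bc subrK.
- by rewrite ad addrK.
Qed.

Context (M : lmodType A) (v : M).
Context (two_reg : forall w : M, w + w = 0 -> w = 0).
Context (fv : f *: v = 0).
Context (acv : a * c *: v = 0).

(** Apply f to a c v = 0. *)
Lemma bcad_v : (a * d + b * c) *: v = 0.
Proof.
have e : f * (a * c) = a * c * f + (a * d + b * c).
  rewrite mulrA (rel_fa rels) mulrDl -mulrA (rel_fc rels) mulrDr mulrA.
  by rewrite -!addrA.
have := congr1 (fun x => x *: v) e.
by rewrite scalerDl -(scalerA f) -(scalerA _ f) acv fv !scaler0 add0r.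
Qed.

(** Apply f once more. *)
Lemma bd_v : b * d *: v = 0.
Proof.
apply: two_reg; rewrite -scalerDl.
have e : f * (a * d + b * c) = (a * d + b * c) * f + (b * d + b * d).
  rewrite mulrDr !mulrA (rel_fa rels) (rel_fb rels) !mulrDl -!mulrA.
  rewrite (rel_fd rels) (rel_fc rels) mulrDr !addrA; congr (_ + _).
  by rewrite addrAC.
have := congr1 (fun x => x *: v) e.
by rewrite scalerDl -(scalerA f) -(scalerA _ f) bcad_v fv !scaler0 add0r scalerDl.
Qed.

(** Apply a to the relation bcad_v; the term in b is b a c v = 0. *)
Lemma aad_v : a * (a * d) *: v = 0.
Proof.
have e : a * (a * d + b * c) = a * (a * d) + b * (a * c).
  by rewrite mulrDr; congr (_ + _); rewrite mulrA (rel_ab rels) mulrA.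
have := congr1 (fun x => x *: v) e.
by rewrite scalerDl -scalerA bcad_v -[X in _ = _ + X]scalerA acv !scaler0 addr0.
Qed.

(** Apply d to the relation bcad_v, written as (d a + c b) v = 0. *)
Lemma dda_v : d * (d * a) *: v = 0.
Proof.
have w : d * a + c * b = a * d + b * c.
  by rewrite (rel_ad rels) (rel_bc rels) addrACA subrr addr0.
have e : d * (a * d + b * c) = d * (d * a) + c * (b * d).
  rewrite -w mulrDr; congr (_ + _).
  by rewrite mulrA -(rel_cd rels) -mulrA (rel_bd rels).
have := congr1 (fun x => x *: v) e.
by rewrite scalerDl -scalerA bcad_v -[X in _ = _ + X]scalerA bd_v !scaler0 addr0.
Qed.

Lemma bc_da_v : b * c *: v + d * a *: v = - (z *: v).
Proof.
have := bcad_v; rewrite (rel_ad rels) !scalerDl => e.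
by apply/eqP; rewrite -addr_eq0 -addrA addrC e.
Qed.

Lemma rel_adX j : a * d ^+ j = d ^+ j * a + (z * d ^+ j.-1) *+ j.
Proof.
elim: j => [|j IH]; first by rewrite expr0 mul1r mulr1 mulr0n addr0.
rewrite exprSr mulrA IH mulrDl -mulrA (rel_ad rels) mulrDr mulrA -exprSr -addrA.
congr (_ + _); rewrite mulrnAl mulrS.
case: j {IH} => [|j]; first by rewrite !mulr0n !addr0 expr0 mul1r mulr1.
rewrite /= -mulrA -exprSr.
by rewrite (commrX j.+1 (esym (rel_dz rels)) : z * d ^+ j.+1 = _).
Qed.

Lemma rel_fX i j : f * (a ^+ i * b ^+ j) =
  a ^+ i * b ^+ j * f + (a ^+ i.-1 * b ^+ j.+1) *+ i.
Proof.
have fbX : f * b ^+ j = b ^+ j * f by apply: commrX; apply: rel_fb rels.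
elim: i => [|i IH]; first by rewrite expr0 !mul1r mulr0n addr0.
have baX : b * a ^+ i = a ^+ i * b by apply: commrX; apply/esym; apply: rel_ab rels.
have -> : f * (a ^+ i.+1 * b ^+ j) = a * (f * (a ^+ i * b ^+ j)) + b * (a ^+ i * b ^+ j).
  by rewrite exprS !mulrA (rel_fa rels) !mulrDl.
rewrite IH mulrDr -addrA; congr (_ + _); first by rewrite exprS !mulrA.
rewrite mulrA baX -mulrA -exprS mulrS addrC; congr (_ + _).
by case: i {IH baX} => [|i]; rewrite ?mulr0n ?mulr0 //= mulrnAr mulrA -exprS.
Qed.

(* S stands for the span of the normal vectors; the lemmas of this section push one
   generator of n^- through each kind of normal vector. *)
Context (S : M -> Prop).
Context (S0 : S 0).
Context (SD : forall x y, S x -> S y -> S (x + y)).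
Context (SN : forall x, S x -> S (- x)).
Context (Sz : forall x, S x -> S (z *: x)).
Context (SL : forall i j, S (a ^+ i * b ^+ j *: v)).
Context (SR : forall i j, S (c ^+ i * d ^+ j *: v)).
Context (Sda : S (d * a *: v)).

Let SMn x n : S x -> S (x *+ n).
Proof. by move=> Sx; elim: n => [|n IH]; rewrite ?mulr0n // mulrS; apply: SD. Qed.

Lemma stable_aL i j : S (a *: (a ^+ i * b ^+ j *: v)).
Proof. by rewrite scalerA mulrA -exprS. Qed.

Lemma stable_ada : S (a *: (d * a *: v)).
Proof.
have e : a * (d * a) = a * (a * d) - z * a.
  by rewrite (rel_ad rels) mulrDr (rel_az rels) addrK.
rewrite scalerA e scalerBl aad_v sub0r -scalerA; apply/SN/Sz.
by have := SL 1 0; rewrite expr1 expr0 mulr1.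
Qed.

Lemma stable_abc : S (a *: (b * c *: v)).
Proof. by rewrite scalerA mulrA (rel_ab rels) -mulrA -scalerA acv scaler0. Qed.

(** Moving a to the right past d^j costs j z d^(j-1). The term with a on the right
    dies on v as soon as c occurs, or d occurs twice; what is left is a v or d a v. *)
Lemma stable_aR i j : S (a *: (c ^+ i * d ^+ j *: v)).
Proof.
have acX : a * c ^+ i = c ^+ i * a by apply: commrX; apply: rel_ac rels.
rewrite scalerA mulrA acX -mulrA rel_adX mulrDr scalerDl; apply: SD; last first.
  rewrite mulrnAr -scalerMnl; apply: SMn.
  have -> : c ^+ i * (z * d ^+ j.-1) = z * (c ^+ i * d ^+ j.-1).
    have zcX : z * c ^+ i = c ^+ i * z by apply: commrX; apply/esym; apply: rel_cz rels.
    by rewrite !mulrA zcX.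
  by rewrite -scalerA; apply/Sz.
case: i {acX} => [|i]; last first.
  have dcX : d ^+ j * c = c * d ^+ j by apply/esym/commrX; apply: rel_cd rels.
  rewrite exprSr -mulrA [c * _]mulrA -dcX -[d ^+ j * c * a]mulrA -(rel_ac rels).
  by rewrite -2!scalerA acv !scaler0.
rewrite expr0 mul1r; case: j => [|[|j]].
- by have := SL 1 0; rewrite expr1 expr0 mulr1 mul1r.
- by rewrite expr1.
- by rewrite !exprSr -!mulrA -scalerA dda_v scaler0.
Qed.

Lemma stable_fL i j : S (f *: (a ^+ i * b ^+ j *: v)).
Proof.
rewrite scalerA rel_fX scalerDl -scalerA fv scaler0 add0r -scalerMnl.
exact: SMn.
Qed.

Lemma stable_fda : S (f *: (d * a *: v)).
Proof.
rewrite scalerA mulrA (rel_fd rels) -mulrA (rel_fa rels) mulrDr scalerDl mulrA.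
by rewrite -scalerA fv scaler0 add0r -(rel_bd rels) bd_v.
Qed.

End Lower.

Section LowerRels.
Context (K : numFieldType).
Local Notation U := (Usl4 K).
Local Notation XE i j := (U_inj (sl4_E K i j) : U).

Lemma lower_rels_U :
  lower_rels (U_a K) (U_b K) (U_c K) (U_d K) (U_z K) (U_f K).
Proof.
split; rewrite /U_d ?mulrN ?mulNr.
- by rewrite /U_f /U_a (XE_comm1 K (j := i1)).
- by rewrite XE_comm0.
- by rewrite /U_f /U_c (XE_comm1 K (i := i3) (j := i2)) // addrK.
- by rewrite XE_comm0.
- by rewrite XE_comm0.
- by rewrite XE_comm0.
- by rewrite XE_comm0.
- by rewrite XE_comm0.
- by rewrite XE_comm0.
- by rewrite /U_z /U_a (XE_comm1 K (i := i3) (j := i1)) // opprD addrNK.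
- by rewrite /U_z /U_c /U_b (XE_comm1 K (i := i3) (j := i2)) // addrK.
- by rewrite XE_comm0.
- by rewrite XE_comm0.
- by rewrite XE_comm0.
- by rewrite XE_comm0.
Qed.

(** The smallest subspace that contains v and is stable under f_1, f_2 and f_3. *)
Inductive lower_span (M : lmodType U) (v : M) : M -> Prop :=
| lower_span_vac : lower_span v v
| lower_spanP (k : K) x y : lower_span v x -> lower_span v y ->
    lower_span v (scal k *: x + y)
| lower_span_a x : lower_span v x -> lower_span v (U_a K *: x)
| lower_span_c x : lower_span v x -> lower_span v (U_c K *: x)
| lower_span_f x : lower_span v x -> lower_span v (U_f K *: x).

Lemma sl4_h1E : sl4_h K node1 = delta_mx i0 i0 - delta_mx i1 i1 :> 'M[K]_4.
Proof. by congr (delta_mx _ _ - delta_mx _ _); apply/val_inj. Qed.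
Lemma sl4_h2E : sl4_h K node2 = delta_mx i1 i1 - delta_mx i2 i2 :> 'M[K]_4.
Proof. by congr (delta_mx _ _ - delta_mx _ _); apply/val_inj. Qed.
Lemma sl4_h3E : sl4_h K node3 = delta_mx i2 i2 - delta_mx i3 i3 :> 'M[K]_4.
Proof. by congr (delta_mx _ _ - delta_mx _ _); apply/val_inj. Qed.

Lemma lower_part (x : 'M[K]_4) :
  \matrix_(i, j) (x i j *+ (j < i)%N) =
  x i1 i0 *: delta_mx i1 i0 + (x i2 i0 *: delta_mx i2 i0 +
  (x i3 i0 *: delta_mx i3 i0 + (x i2 i1 *: delta_mx i2 i1 +
  (x i3 i1 *: delta_mx i3 i1 + x i3 i2 *: delta_mx i3 i2)))).
Proof. by apply/matrixP; elim/ord4P; elim/ord4P; rewrite !mxE /=; ring. Qed.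

(** Here c1, c2, c3 are the coordinates of the diagonal of x on h_1, h_2, h_3. *)
Lemma upper_part (x : 'M[K]_4) (i j : 'I_4) : \tr x = 0 -> (j <= i)%N ->
  let c1 := x i0 i0 in let c2 := c1 + x i1 i1 in let c3 := c2 + x i2 i2 in
  x i j - (x i j *+ (j < i)%N +
    (c1 * (delta_mx i0 i0 - delta_mx i1 i1 : 'M[K]_4) i j +
    (c2 * (delta_mx i1 i1 - delta_mx i2 i2 : 'M[K]_4) i j +
     c3 * (delta_mx i2 i2 - delta_mx i3 i3 : 'M[K]_4) i j))) = 0.
Proof.
rewrite /mxtrace !big_ord_recl big_ord0 addr0.
rewrite (_ : ord0 = i0); last exact/val_inj.
rewrite (_ : lift _ _ = i1); last exact/val_inj.
rewrite (_ : lift _ _ = i2); last exact/val_inj.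
rewrite (_ : lift _ _ = i3); last exact/val_inj.
move=> tr ji; rewrite !mxE; move: ji.
rewrite leq_eqVlt => /orP[/eqP/val_inj e|ji]; last first.
  have d (l : 'I_4) : (i == l) && (j == l) = false.
    apply/negP => /andP[/eqP il /eqP jl]; move: ji; by rewrite il jl ltnn.
  by rewrite ji !d /= mulr1n; ring.
rewrite e ltnn mulr0n {j e}.
have e3 : x i3 i3 = - (x i0 i0 + x i1 i1 + x i2 i2).
  by apply/eqP; rewrite -addr_eq0 -tr; apply/eqP; ring.
move: i; elim/ord4P; rewrite /= ?e3; ring.
Qed.

Section LowerSpan.
Context (M : lmodType U) (v : M).
Context (v_gens : forall u, verma_gens 0 u -> (u : U) *: v = 0).
Local Notation W := (lower_span v).

Lemma lower_span0 : W 0.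
Proof.
rewrite (_ : 0 = scal (-1) *: v + v); first by apply: lower_spanP; apply: lower_span_vac.
by rewrite scalN scal1 scaleN1r addNr.
Qed.

Lemma lower_spanD x y : W x -> W y -> W (x + y).
Proof. by move=> Wx Wy; rewrite -[x]scale1r -(scal1 K); apply: lower_spanP. Qed.

Lemma lower_spanZ (k : K) x : W x -> W (scal k *: x).
Proof. by move=> Wx; rewrite -[_ *: x]addr0; apply: lower_spanP => //; apply: lower_span0. Qed.

Lemma lower_spanB x y : W x -> W y -> W (x - y).
Proof.
by move=> Wx Wy; apply: lower_spanD => //; rewrite -scaleN1r -(scal1 K) -scalN; apply: lower_spanZ.
Qed.

Lemma lower_span_b x : W x -> W (U_b K *: x).
Proof.
move=> Wx; have -> : U_b K *: x = U_f K *: (U_a K *: x) - U_a K *: (U_f K *: x).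
  by rewrite !scalerA (rel_fa lower_rels_U) scalerDl addrAC subrr add0r.
by apply: lower_spanB; [exact: lower_span_f (lower_span_a Wx)|
  exact: lower_span_a (lower_span_f Wx)].
Qed.

Lemma lower_span_d x : W x -> W (U_d K *: x).
Proof.
move=> Wx; have -> : U_d K *: x = U_f K *: (U_c K *: x) - U_c K *: (U_f K *: x).
  by rewrite !scalerA (rel_fc lower_rels_U) scalerDl addrAC subrr add0r.
by apply: lower_spanB; [exact: lower_span_f (lower_span_c Wx)|
  exact: lower_span_c (lower_span_f Wx)].
Qed.

Lemma lower_span_z x : W x -> W (U_z K *: x).
Proof.
move=> Wx; have -> : U_z K *: x = U_a K *: (U_d K *: x) - U_d K *: (U_a K *: x).
  by rewrite !scalerA (rel_ad lower_rels_U) scalerDl addrAC subrr add0r.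
by apply: lower_spanB; [exact: lower_span_a (lower_span_d Wx)|
  exact: lower_span_d (lower_span_a Wx)].
Qed.

Lemma U_injP k (x y : sl4 K) : U_inj (k *: x + y) = k *: U_inj x + U_inj y.
Proof. exact: env_inj_linear. Qed.

Lemma lower_span_sl4_vac (x : sl4 K) : W (U_inj x *: v).
Proof.
have step (k : K) (y w : sl4 K) : W (U_inj y *: v) -> W (U_inj w *: v) ->
    W (U_inj (k *: y + w) *: v).
  by move=> Wy Ww; rewrite U_injP scalerDl -scal_mull -scalerA; apply: lower_spanP.
have hv k : U_inj (sl4_h K k) *: v = 0.
  by have := v_gens (or_intror (ex_intro _ k erefl)); rewrite mxE scale0r subr0.
have uv y : sl4_upper y -> U_inj y *: v = 0.
  by move=> uy; apply: v_gens; left; exists y.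
have Wd : W (U_inj (sl4_E K i3 i1) *: v).
  rewrite -[_ *: v]opprK -[- (_ *: v)]scaleNr -sub0r.
  by apply: lower_spanB; [exact: lower_span0|exact: (lower_span_d (lower_span_vac v))].
pose c1 := x i0 i0; pose c2 := c1 + x i1 i1; pose c3 := c2 + x i2 i2.
pose E i j : sl4 K := x i j *: sl4_E K i j.
pose H : sl4 K := c1 *: sl4_h K node1 + (c2 *: sl4_h K node2 + c3 *: sl4_h K node3).
(* The strictly upper triangular part of x. *)
pose y := x - (E i1 i0 + (E i2 i0 + (E i3 i0 + (E i2 i1 + (E i3 i1 + E i3 i2)))) + H).
have {1}-> : x = E i1 i0 + (E i2 i0 + (E i3 i0 + (E i2 i1 + (E i3 i1 + (E i3 i2 +
    (c1 *: sl4_h K node1 + (c2 *: sl4_h K node2 + (c3 *: sl4_h K node3 + y)))))))).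
  by rewrite -[LHS](subrK (E i1 i0 + (E i2 i0 + (E i3 i0 + (E i2 i1 + (E i3 i1 +
    E i3 i2)))) + H) x) -/y [LHS]addrC /H !addrA.
apply: (step _ _ _); first exact: (lower_span_a (lower_span_vac v)).
apply: (step _ _ _); first exact: (lower_span_b (lower_span_vac v)).
apply: (step _ _ _); first exact: (lower_span_z (lower_span_vac v)).
apply: (step _ _ _); first exact: (lower_span_f (lower_span_vac v)).
apply: (step _ _ _); first exact: Wd.
apply: (step _ _ _); first exact: (lower_span_c (lower_span_vac v)).
do 3! [apply: (step _ _ _); first by rewrite hv; apply: lower_span0].
rewrite uv; first exact: lower_span0.
have yE : y = (x : 'M[K]_4) - (x i1 i0 *: (sl4_E K i1 i0 : 'M[K]_4) +
  (x i2 i0 *: (sl4_E K i2 i0 : 'M[K]_4) + (x i3 i0 *: (sl4_E K i3 i0 : 'M[K]_4) +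
  (x i2 i1 *: (sl4_E K i2 i1 : 'M[K]_4) + (x i3 i1 *: (sl4_E K i3 i1 : 'M[K]_4) +
  x i3 i2 *: (sl4_E K i3 i2 : 'M[K]_4))))) + (c1 *: (sl4_h K node1 : 'M[K]_4) +
  (c2 *: (sl4_h K node2 : 'M[K]_4) + c3 *: (sl4_h K node3 : 'M[K]_4))))
    :> 'M[K]_4 by [].
rewrite !sl4_EE // sl4_h1E sl4_h2E sl4_h3E -lower_part in yE.
move=> i j ji; rewrite yE; have /eqP trx := valP x.
rewrite -[RHS](upper_part trx ji) [LHS]mxE; congr (_ + _).
rewrite [LHS]mxE; congr (- _).
rewrite [LHS]mxE [X in X + _]mxE; congr (_ + _).
by rewrite [LHS]mxE [X in X + _]mxE [X in _ + X]mxE [X in _ + (X + _)]mxE [X in _ + (_ + X)]mxE.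
Qed.

(** As x y = y x + [x, y] and [x, y] is again in sl4, stability under all of sl4
    is inherited along f_1, f_2, f_3 from the vector v; this replaces the
    triangular decomposition of U(sl4). *)
Lemma lower_span_sl4 w : W w -> forall x : sl4 K, W (U_inj x *: w).
Proof.
have comm (x y : sl4 K) (u : M) : W (U_inj x *: u) -> W (U_inj (sl4_br x y) *: u) ->
    (forall u', W u' -> W (U_inj y *: u')) -> W (U_inj x *: (U_inj y *: u)).
  move=> Wx Wxy Wy; have -> : U_inj x *: (U_inj y *: u) =
      U_inj y *: (U_inj x *: u) + U_inj (sl4_br x y) *: u.
    by rewrite !scalerA -scalerDl /U_inj env_inj_br addrC subrK.
  by apply: lower_spanD => //; apply: Wy.
elim=> {w} [|k y w Wy IHy Ww IHw|w Ww IH|w Ww IH|w Ww IH] x.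
- exact: lower_span_sl4_vac.
- by rewrite scalerDr scal_comm; apply: lower_spanP; [apply: IHy|apply: IHw].
- by apply: comm; [exact: IH|exact: IH|exact: lower_span_a].
- by apply: comm; [exact: IH|exact: IH|exact: lower_span_c].
- by apply: comm; [exact: IH|exact: IH|exact: lower_span_f].
Qed.

Lemma lower_span_env (u : U) : W (u *: v).
Proof.
elim/(@env_ind _ _ (@sl4_br K)): u => [|k u w Wu Ww|x u Wu].
- by rewrite scale1r; apply: lower_span_vac.
- by rewrite scalerDl -scal_mull -scalerA; apply: lower_spanP.
- by rewrite -scalerA; apply: lower_span_sl4.
Qed.

End LowerSpan.

Lemma MM_pi (u : U) : u *: MM_vac K =
  \pi_(quotmod (addsm (@MM_sub13 K) (@MM_sub2 K)))
    (\pi_(quotmod (submod_span (verma_gens 0))) (u : U^o)).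
Proof.
rewrite /MM_vac -[LHS]quotmod_piZ; congr (\pi_ _ _).
rewrite -[LHS]quotmod_piZ; congr (\pi_ _ _); exact: mulr1.
Qed.

Lemma MM_cyclic (w : MM K) : exists u : U, w = u *: MM_vac K.
Proof. by exists (repr (repr w : verma 0)); rewrite MM_pi !reprK. Qed.

Lemma MM_vac_gens u : verma_gens 0 u -> (u : U) *: MM_vac K = 0.
Proof.
move=> gu; rewrite MM_pi.
have -> : \pi_(quotmod (submod_span (verma_gens 0))) (u : U^o) = 0.
  have <- : \pi_(quotmod (submod_span (verma_gens 0))) (0 : U^o) = 0.
    by apply: (addrI (\pi_(quotmod (submod_span (verma_gens 0))) (0 : U^o)));
      rewrite -quotmod_piD !addr0.
  by apply/eqP; rewrite quotmod_piB subr0; apply: submod_span_gen.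
by apply: (addrI (\pi_(quotmod (addsm (@MM_sub13 K) (@MM_sub2 K))) 0));
  rewrite -quotmod_piD !addr0.
Qed.

Lemma verma_vac_wt0 :
  wt_space 0 (\pi_(quotmod (submod_span (verma_gens (0 : weight K)))) (1 : U^o) : verma 0).
Proof.
move=> k; rewrite -[LHS]quotmod_piZ -[RHS]quotmod_piZ.
apply/eqP; rewrite quotmod_piB; apply: submod_span_gen; right; exists k.
by rewrite -scalerBl; apply: mulr1.
Qed.

Lemma MM_pi_eq0 (x : verma 0) :
  (x \in @MM_sub13 K) || (x \in @MM_sub2 K) ->
  \pi_(quotmod (addsm (@MM_sub13 K) (@MM_sub2 K))) x = 0.
Proof.
move=> xP; have <- : \pi_(quotmod (addsm (@MM_sub13 K) (@MM_sub2 K))) 0 = 0.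
  by apply: (addrI (\pi_(quotmod (addsm (@MM_sub13 K) (@MM_sub2 K))) 0));
    rewrite -quotmod_piD !addr0.
apply/eqP; rewrite quotmod_piB subr0; apply/asboolP.
by case/orP: xP => xP; [exists x, 0|exists 0, x]; split; rewrite ?addr0 ?add0r ?rpred0.
Qed.

Lemma U_f_MM_vac : U_f K *: MM_vac K = 0.
Proof.
rewrite /MM_vac -[LHS]quotmod_piZ; apply: MM_pi_eq0; apply/orP; right.
apply: submod_span_gen; exists (\pi_(quotmod (submod_span (verma_gens 0))) (1 : U^o)).
  exact: verma_vac_wt0.
by rewrite f2E.
Qed.

Lemma U_ac_MM_vac : U_a K * U_c K *: MM_vac K = 0.
Proof.
rewrite /MM_vac -[LHS]quotmod_piZ; apply: MM_pi_eq0; apply/orP; left.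
apply: submod_span_gen; exists (\pi_(quotmod (submod_span (verma_gens 0))) (1 : U^o)).
  exact: verma_vac_wt0.
by rewrite f1E f3E.
Qed.

End LowerRels.

Lemma nz_diracE (K : numFieldType) f m : nz_dirac (K := K) f m ->
  f m != 0 /\ forall m', f m' = (m' == m)%:R * f m.
Proof.
case=> c c0 ->.
have E m' : (c *: dirac K m) m' = c * (m' == m)%:R by [].
by split=> [|m']; rewrite !E eqxx mulr1 // mulrC.
Qed.

(** * Expansion along a family of vectors with dual coordinates *)

Section DualFamily.
Context (K : fieldType) (A : algType K) (M : lmodType A) (I : eqType).
Context (b : I -> M) (c : I -> M -> K).
Context (cP : forall t k x y, c t (k%:A *: x + y) = k * c t x + c t y).
Context (cb : forall t t', b t' = 0 \/ c t' (b t) = (t == t')%:R).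

(** Asking for the expansion on every finite index set that is large enough makes
    this property visibly stable under linear combinations. *)
Definition expands (w : M) := exists s : seq I,
  forall s', uniq s' -> {subset s <= s'} -> w = \sum_(t <- s') (c t w)%:A *: b t.

Lemma dual0 t : c t 0 = 0.
Proof.
have := cP t (-1) 0 0; rewrite scaler0 addr0 => e.
by rewrite e mulN1r addNr.
Qed.

Lemma expands_basis t : expands (b t).
Proof.
exists [:: t] => s' us' ts'.
have {}ts' : t \in s' by apply: ts'; rewrite mem_head.
rewrite (bigD1_seq t) //= big1 => [|t' t't]; last first.
  case: (cb t t') => [->|->]; first by rewrite scaler0.
  by rewrite eq_sym (negbTE t't) scale0r scale0r.
rewrite addr0; case: (cb t t) => [e|->]; last by rewrite eqxx !scale1r.
by rewrite e scaler0.
Qed.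

Lemma expandsP k x y : expands x -> expands y -> expands (k%:A *: x + y).
Proof.
case=> s Es [s2 Es2]; exists (s ++ s2) => s' us' ss'.
have sub1 : {subset s <= s'} by move=> t ts; apply: ss'; rewrite mem_cat ts.
have sub2 : {subset s2 <= s'} by move=> t ts; apply: ss'; rewrite mem_cat ts orbT.
rewrite [in LHS](Es s' us' sub1) [in LHS](Es2 s' us' sub2) scaler_sumr -big_split.
apply: eq_bigr => t _ /=.
by rewrite cP scalerDl scalerDl scalerA mulr_algl scalerA.
Qed.

Lemma expands0 : expands 0.
Proof. by exists [::] => s' _ _; rewrite big1 // => t _; rewrite dual0 !scale0r. Qed.

Lemma expandsZ k x : expands x -> expands (k%:A *: x).
Proof. by move=> Ex; rewrite -[_ *: x]addr0; apply: expandsP => //; apply: expands0. Qed.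

Lemma expandsD x y : expands x -> expands y -> expands (x + y).
Proof. by move=> Ex Ey; rewrite -[x]scale1r -(scale1r (1 : A)); apply: expandsP. Qed.

Lemma expandsN x : expands x -> expands (- x).
Proof. by move=> Ex; rewrite -scaleN1r -scaleN1r; apply: expandsZ. Qed.

Lemma expands_act (u : A) : (forall t, expands (u *: b t)) ->
  forall w, expands w -> expands (u *: w).
Proof.
move=> Eu w [s Es]; have := Es (undup s) (undup_uniq s).
move=> -> => [|t]; last by rewrite mem_undup.
rewrite scaler_sumr; apply: big_ind => [||t _].
- exact: expands0.
- exact: expandsD.
- by rewrite scalerA mulr_algr -mulr_algl -scalerA; apply: expandsZ.
Qed.

Lemma expands_sub (T : seq I) w : uniq T -> expands w ->
  (forall t, t \notin T -> b t = 0 \/ c t w = 0) ->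
  w = \sum_(t <- T) (c t w)%:A *: b t.
Proof.
move=> uT [s Es] cT.
have {1}-> := Es (undup (T ++ s)) (undup_uniq _); last first.
  by move=> t ts; rewrite mem_undup mem_cat ts orbT.
rewrite (bigID (mem T)) /= [X in _ + X]big1 ?addr0 => [|t tT]; last first.
  by case: (cT t tT) => ->; rewrite ?scaler0 // !scale0r.
rewrite -big_filter; apply: perm_big; apply: uniq_perm => //.
  by rewrite filter_uniq // undup_uniq.
move=> t; rewrite mem_filter mem_undup mem_cat; by case: (t \in T).
Qed.

Lemma expands_dim (W : M -> Prop) (T : seq I) : uniq T ->
    (forall t, t \in T -> b t != 0) ->
    W 0 -> (forall k x y, W x -> W y -> W (k%:A *: x + y)) ->
    (forall t, t \in T -> W (b t)) ->
    (forall w, W w -> expands w) ->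
    (forall w t, W w -> t \notin T -> b t = 0 \/ c t w = 0) ->
  exists2 f : 'I_(size T) -> M,
    (forall d : 'I_(size T) -> K, \sum_i (d i)%:A *: f i = 0 -> forall i, d i = 0) &
    (forall v, W v <-> exists d : 'I_(size T) -> K, v = \sum_i (d i)%:A *: f i).
Proof.
move=> uT bT W0 WP WbT WE WT.
exists (fun i => b (tnth (in_tuple T) i)).
  move=> d e i; have ci : c (tnth (in_tuple T) i) 0 = d i; last by rewrite -ci dual0.
  rewrite -e; have cD : {morph c (tnth (in_tuple T) i) : x y / x + y}.
    by move=> x y; have := cP (tnth (in_tuple T) i) 1 x y; rewrite !scale1r mul1r.
  rewrite (big_morph _ cD (dual0 _)) (bigD1 i) //= big1 ?addr0 => [|j ji].
    rewrite -[X in c _ X]addr0 cP dual0 addr0.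
    case: (cb (tnth (in_tuple T) i) (tnth (in_tuple T) i)) => [e0|->].
      by have := bT _ (mem_tnth i (in_tuple T)); rewrite e0 eqxx.
    by rewrite eqxx mulr1.
  rewrite -[X in c _ X]addr0 cP dual0 addr0.
  case: (cb (tnth (in_tuple T) j) (tnth (in_tuple T) i)) => [e0|->].
    by have := bT _ (mem_tnth i (in_tuple T)); rewrite e0 eqxx.
  suff /negbTE -> : tnth (in_tuple T) j != tnth (in_tuple T) i by rewrite mulr0.
  by apply: contra ji => /eqP/(tuple_uniqP (in_tuple T) uT) ->.
move=> v; split=> [Wv|[d ->]]; last first.
  apply: big_ind => [//|x y Wx Wy|i _].
    by rewrite -[x]scale1r -(scale1r (1 : A)); apply: WP.
  by rewrite -[_ *: _]addr0; apply: WP => //; apply: WbT; apply: mem_tnth.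
exists (fun i => c (tnth (in_tuple T) i) v).
rewrite {1}(expands_sub uT (WE v Wv) (fun t => @WT v t Wv)).
by rewrite big_tnth.
Qed.

End DualFamily.

Lemma two_torsion_free (K : numFieldType) (A : algType K) (M : lmodType A) (w : M) :
  w + w = 0 -> w = 0.
Proof.
have half : (2^-1 : K)%:A * (1 + 1) = 1 :> A.
  rewrite mulr_algl scalerDr -scalerDl (_ : 2^-1 + 2^-1 = 1 :> K) ?scale1r //.
  by field.
move=> ww; rewrite -[LHS]scale1r -half -scalerA scalerDl scale1r ww.
exact: scaler0.
Qed.

Section Spanning.
Context (A : pzRingType) (a b c d z f : A) (M : lmodType A) (v : M).
Local Notation t0 := ((0, 0, 0)%N : triple).

(** The index (false, (0, 0, 0)) is a dummy: it would repeat the vector v. *)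
Definition nvec (t : bool * triple) : M :=
  if t.1 then nmon a b d z t.2 *: v
  else if t.2 == t0 then 0 else nmon c d b z t.2 *: v.

Lemma nmon0 (a' b' d' : A) : nmon a' b' d' z t0 = 1.
Proof. by rewrite /nmon /= !expr0 !mulr1. Qed.

Lemma nmon_mulz (a' b' d' : A) i j k : (i, j, k) != t0 ->
  z * nmon a' b' d' z (i, j, k) = nmon a' b' d' z (i, j, k.+1).
Proof.
move=> tn0; rewrite /nmon /= andbT.
case: (eqVneq (i, j) (0, 0)%N) tn0 => [[-> ->]|_ _] /=.
  by case: k => // k _; rewrite !mulrA -exprS.
by rewrite /= !mulrA -exprS.
Qed.

Lemma nvec_L0 : nvec (true, t0) = v.
Proof. by rewrite /nvec /= nmon0 scale1r. Qed.

Context (rels : lower_rels a b c d z f).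
Context (two_reg : forall w : M, w + w = 0 -> w = 0).
Context (fv : f *: v = 0).
Context (acv : a * c *: v = 0).
Context (S : M -> Prop).
Context (S0 : S 0).
Context (SD : forall x y, S x -> S y -> S (x + y)).
Context (SN : forall x, S x -> S (- x)).
Context (S_act : forall u, (forall t, S (u *: nvec t)) -> forall w, S w -> S (u *: w)).
Context (S_nvec : forall t, S (nvec t)).

Lemma span_L i j : S (a ^+ i * b ^+ j *: v).
Proof.
have := S_nvec (true, (i, j, 0)%N); rewrite /nvec /nmon /=.
by rewrite andbF expr0 mul1r.
Qed.

Lemma span_R i j : S (c ^+ i * d ^+ j *: v).
Proof.
have := S_nvec (false, (i, j, 0)%N); rewrite /nvec /nmon /=.
case: eqP => [[-> ->] _|_].
  by rewrite !expr0 mul1r scale1r -nvec_L0.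
by rewrite andbF expr0 mul1r.
Qed.

Lemma span_da : S (d * a *: v).
Proof.
by have := S_nvec (true, (0, 0, 1)%N); rewrite /nvec /nmon /= expr0 mul1r.
Qed.

Lemma span_bc : S (b * c *: v).
Proof.
by have := S_nvec (false, (0, 0, 1)%N); rewrite /nvec /nmon /= expr0 mul1r.
Qed.

(** Multiplication by z raises the last index, except at v itself, where it gives
    - (b c v + d a v). *)
Lemma span_z w : S w -> S (z *: w).
Proof.
apply: S_act => -[[] [[i j] k]].
  have [->|tn0] := eqVneq (i, j, k) t0.
    rewrite nvec_L0 -[_ *: v]opprK -(bc_da_v rels fv acv).
    by apply/SN/SD; [exact: span_bc|exact: span_da].
  have := S_nvec (true, (i, j, k.+1)).
  by rewrite /nvec /= scalerA nmon_mulz.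
rewrite /nvec /=; have [_|tn0] := eqVneq (i, j, k) t0; first by rewrite scaler0.
rewrite scalerA nmon_mulz //; have := S_nvec (false, (i, j, k.+1)).
by rewrite /nvec /= xpair_eqE andbF.
Qed.

Lemma span_zX n w : S w -> S (z ^+ n *: w).
Proof.
elim: n => [|n IH] Sw; first by rewrite expr0 scale1r.
by rewrite exprS -scalerA; apply/span_z/IH.
Qed.

Lemma span_nmon (x a' b' d' : A) : x * z = z * x -> S (x *: (d' * a' *: v)) ->
    (forall i j, S (x *: (a' ^+ i * b' ^+ j *: v))) ->
  forall t, S (x *: (nmon a' b' d' z t *: v)).
Proof.
move=> xz Sda Sab [[i j] k].
have xzn n : x * z ^+ n = z ^+ n * x by apply: commrX.
rewrite /nmon /=; case: ifP => _; rewrite -mulrA scalerA mulrA xzn -mulrA -scalerA.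
  by apply: span_zX; rewrite -scalerA.
by apply: span_zX; rewrite -scalerA.
Qed.

Lemma span_nvec (x : A) : x * z = z * x ->
    (forall t, S (x *: (nmon a b d z t *: v))) ->
    (forall t, S (x *: (nmon c d b z t *: v))) ->
  forall w, S w -> S (x *: w).
Proof.
move=> xz SL SR; apply: S_act => -[[] t]; first exact: SL.
by rewrite /nvec /=; case: ifP => _; [rewrite scaler0; apply: S0|exact: SR].
Qed.

Let swap := lower_rels_swap rels.
Let cav : c * a *: v = 0.
Proof. by rewrite -(rel_ac rels). Qed.

Lemma span_a w : S w -> S (a *: w).
Proof.
apply: span_nvec; first exact: rel_az rels.
  apply: span_nmon; first exact: rel_az rels.
    exact: (stable_ada rels fv acv SN span_z span_L).
  exact: (stable_aL span_L).
apply: span_nmon; first exact: rel_az rels.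
  exact: (stable_abc rels acv S0).
exact: (stable_aR rels two_reg fv acv S0 SD span_z span_L span_R span_da).
Qed.

Lemma span_c w : S w -> S (c *: w).
Proof.
apply: span_nvec; first exact: rel_cz rels.
  apply: span_nmon; first exact: rel_cz rels.
    exact: (stable_abc swap cav S0).
  exact: (stable_aR swap two_reg fv cav S0 SD span_z span_R span_L span_bc).
apply: span_nmon; first exact: rel_cz rels.
  exact: (stable_ada swap fv cav SN span_z span_R).
exact: (stable_aL span_R).
Qed.

Lemma span_f w : S w -> S (f *: w).
Proof.
apply: span_nvec; first exact: rel_fz rels.
  apply: span_nmon; first exact: rel_fz rels.
    exact: (stable_fda rels two_reg fv acv S0).
  exact: (stable_fL rels fv S0 SD span_L).
apply: span_nmon; first exact: rel_fz rels.
  exact: (stable_fda swap two_reg fv cav S0).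
exact: (stable_fL swap fv S0 SD span_R).
Qed.

End Spanning.

Section NormalFormSpan.
Context (K : numFieldType) (A : algType K) (a b c d z f : A).
Context (M : lmodType A) (v : M) (coord : bool * triple -> M -> K).
Local Notation nv := (nvec a b c d z v).
Context (rels : lower_rels a b c d z f).
Context (fv : f *: v = 0) (acv : a * c *: v = 0).
Context (coordP : forall t k x y, coord t (k%:A *: x + y) = k * coord t x + coord t y).
Context (coord_dual : forall t t', nv t' = 0 \/ coord t' (nv t) = (t == t')%:R).

Lemma expands_lower w : expands nv coord w ->
  [/\ expands nv coord (a *: w), expands nv coord (c *: w)
    & expands nv coord (f *: w)].
Proof.
move=> Ew; have E0 := expands0 nv coordP; have ED := expandsD (b := nv) coordP.
have EN := expandsN (b := nv) coordP; have Eact := expands_act (b := nv) coordP.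
have Env := expands_basis coord_dual; have two := @two_torsion_free K A M.
split.
- exact: (span_a rels two fv acv E0 ED EN Eact Env Ew).
- exact: (span_c rels two fv acv E0 ED EN Eact Env Ew).
- exact: (span_f rels two fv acv E0 ED EN Eact Env Ew).
Qed.

End NormalFormSpan.

(** * The weight spaces of MM *)

(* M stands for MM; all that is needed of it is that it is generated by a vector with
   the right relations and maps to both parabolic Verma modules. *)
Section Coordinates.
Context (K : numFieldType).
Local Notation U := (Usl4 K).
Local Notation t0 := ((0, 0, 0)%N : triple).
Context (M : lmodType U) (vac : M).
Context (h1 : {linear M -> repmod (rep1 K)}).
Context (h2 : {linear M -> repmod (rep2 K)}).
Context (h1vac : h1 vac = vac1 K).
Context (h2vac : h2 vac = vac2 K).

Definition idx : Type := bool * triple.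

Definition basis_vec : idx -> M := nvec (U_a K) (U_b K) (U_c K) (U_d K) (U_z K) vac.

(** The first family survives only in rep1 and the second only in rep2, and each
    vector goes to a multiple of a Dirac function there. *)
Definition coord (t : idx) (w : M) : K :=
  if t.1 then (h1 w : _ -> K) (pos1 t.2) / (h1 (basis_vec t) : _ -> K) (pos1 t.2)
  else (h2 w : _ -> K) (pos2 t.2) / (h2 (basis_vec t) : _ -> K) (pos2 t.2).

Definition valid (t : idx) := t != (false, t0).

Lemma h1L t : nz_dirac (h1 (basis_vec (true, t))) (pos1 t).
Proof. by rewrite linearZ_LR h1vac; apply: nmonL_vac1. Qed.

Lemma h2R t : t != t0 -> nz_dirac (h2 (basis_vec (false, t))) (pos2 t).
Proof.
by move=> t_neq0; rewrite /basis_vec /nvec /= (negbTE t_neq0) linearZ_LR h2vac; apply: nmonR_vac2.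
Qed.

Lemma h1R t : h1 (basis_vec (false, t)) = 0.
Proof.
rewrite /basis_vec /nvec /=; case: eqP => [_|/eqP tn0]; first exact: raddf0.
by rewrite linearZ_LR h1vac nmonR_vac1.
Qed.

Lemma h2L t : t != t0 -> h2 (basis_vec (true, t)) = 0.
Proof. by move=> tn0; rewrite linearZ_LR h2vac nmonL_vac2. Qed.

Lemma basis_vec0 : basis_vec (true, t0) = vac.
Proof. exact: nvec_L0. Qed.

Lemma coordP t k x y : coord t (scal k *: x + y) = k * coord t x + coord t y.
Proof.
by rewrite /coord; case: t.1; rewrite linearD linearZ_LR scal_repmod /=;
  rewrite -[LHS]/((k * _ + _) / _) mulrDl mulrA.
Qed.

Lemma coord0 t : coord t 0 = 0.
Proof.
by rewrite /coord; case: t.1; rewrite linear0 -[LHS]/(0 / _) mul0r.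
Qed.

Lemma coord_basis_vec t t' : valid t' -> coord t' (basis_vec t) = (t == t')%:R.
Proof.
have div0 (x y : K) : x = 0 -> x / y = 0 by move=> ->; rewrite mul0r.
have E0 (f : 'rV[int]_4 -> K^o) m : f = 0 -> f m = 0 by move=> ->.
case: t' => [[] s'] vt.
  case: t => [[] s]; rewrite xpair_eqE /=; last first.
    by apply: div0; exact: (E0 (h1 (basis_vec (false, s))) (pos1 s') (h1R s)).
  case: (eqVneq s s') => [->|ss']; first exact/divff/(proj1 (nz_diracE (h1L s'))).
  apply: div0; rewrite (proj2 (nz_diracE (h1L s))) (inj_eq pos1_inj) eq_sym.
  by rewrite (negbTE ss') mul0r.
have sn0 : s' != t0 by apply: contra vt => /eqP ->.
case: t => [[] s]; rewrite xpair_eqE /=.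
  apply: div0; case: (eqVneq s t0) => [->|tn0]; last first.
    exact: (E0 (h2 (basis_vec (true, s))) (pos2 s') (h2L tn0)).
  rewrite basis_vec0 h2vac /vac2 /dirac -pos2_0 (inj_eq pos2_inj) (negbTE sn0) //.
case: (eqVneq s s') => [->|ss']; first exact/divff/(proj1 (nz_diracE (h2R sn0))).
apply: div0; case: (eqVneq s t0) => [->|tn0].
  by rewrite /basis_vec /nvec /= linear0.
rewrite (proj2 (nz_diracE (h2R tn0))) (inj_eq pos2_inj) eq_sym.
by rewrite (negbTE ss') mul0r.
Qed.

Lemma coord_dual t t' : basis_vec t' = 0 \/ coord t' (basis_vec t) = (t == t')%:R.
Proof.
have [vt|/negPn/eqP ->] := boolP (valid t'); last by left.
by right; apply: coord_basis_vec.
Qed.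

Local Notation E := (expands basis_vec coord).

Context (fvac : U_f K *: vac = 0).
Context (acvac : U_a K * U_c K *: vac = 0).
Context (cyc : forall w : M, exists u : U, w = u *: vac).
Context (vgens : forall u, verma_gens 0 u -> (u : U) *: vac = 0).

(** The expandable vectors contain the generator and are stable under f_1, f_2 and
    f_3. *)
Lemma expands_all w : E w.
Proof.
have low x : E x -> [/\ E (U_a K *: x), E (U_c K *: x) & E (U_f K *: x)].
  exact: (expands_lower (lower_rels_U K) fvac acvac coordP coord_dual).
have [u ->] := cyc w; elim: (lower_span_env vgens u) => {w u}
  [|k x y _ Ex _ Ey|x _ Ex|x _ Ex|x _ Ex].
- by rewrite -basis_vec0; apply: (expands_basis coord_dual).
- exact: (expandsP coordP).
- by have [Ea _ _] := low x Ex; exact: Ea.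
- by have [_ Ec _] := low x Ex; exact: Ec.
- by have [_ _ Ef] := low x Ex; exact: Ef.
Qed.

Definition wtt (t : idx) : weight K := if t.1 then wt1 K t.2 else wt2 K t.2.

(** Hence M embeds into the sum of the two parabolic Verma modules. *)
Lemma jointly_injective w : h1 w = 0 -> h2 w = 0 -> w = 0.
Proof.
move=> w1 w2; have := expands_sub (T := [::]) isT (expands_all w).
rewrite big_nil; apply=> t _; right; rewrite /coord w1 w2.
by case: t.1; exact: mul0r.
Qed.

Lemma wt_space_joint mu w : wt_space mu (h1 w) -> wt_space mu (h2 w) -> wt_space mu w.
Proof.
move=> /wt_spaceE wt1 /wt_spaceE wt2; apply/wt_spaceE => k; apply/eqP.
rewrite -subr_eq0; apply/eqP/jointly_injective.
  apply/eqP; rewrite linearB subr_eq0 [X in X == _]linearZ_LR [X in _ == X]linearZ_LR.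
  exact/eqP/wt1.
apply/eqP; rewrite linearB subr_eq0 [X in X == _]linearZ_LR [X in _ == X]linearZ_LR.
exact/eqP/wt2.
Qed.

Lemma wt1_0 : wt1 K t0 = 0.
Proof. by apply/rowP => k; rewrite /wt1 pos1_0 /hval !mxE subrr. Qed.

Lemma wt2_0 : wt2 K t0 = 0.
Proof. by apply/rowP => k; rewrite /wt2 pos2_0 /hval !mxE subrr oppr0. Qed.

Lemma wt_basis_vec t : wt_space (wtt t) (basis_vec t).
Proof.
apply: wt_space_joint; case: t => [[] t].
- exact/wt_space_dirac1/h1L.
- by rewrite h1R; apply: wt_space0.
- have [->|tn0] := eqVneq t t0; last by rewrite h2L //; apply: wt_space0.
  rewrite basis_vec0 h2vac /wtt /= wt1_0 -wt2_0; apply: wt_space_dirac2.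
  by rewrite pos2_0; apply: nz_dirac0.
- have [->|tn0] := eqVneq t t0; last exact/wt_space_dirac2/h2R.
  by rewrite /basis_vec /nvec /= linear0; apply: wt_space0.
Qed.

Lemma basis_vec_neq0 t : valid t -> basis_vec t != 0.
Proof.
move=> vt; apply/eqP => b0; have := coord_basis_vec t vt; rewrite b0 coord0 eqxx.
by move/eqP; rewrite eq_sym oner_eq0.
Qed.

Lemma wt_coord mu w t : wt_space mu w -> coord t w != 0 -> mu = wtt t.
Proof.
move=> ww; case: t => [[] t]; rewrite /coord /= mulf_eq0 => /norP[nz _].
  exact: wt_space1 (wt_space_linear h1 ww) (cone_pos1 t) nz.
exact: wt_space2 (wt_space_linear h2 ww) (cone_pos2 t) nz.
Qed.

Lemma wt_dim mu (T : seq idx) : uniq T ->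
    (forall t, t \in T -> valid t /\ wtt t = mu) ->
    (forall t, valid t -> wtt t = mu -> t \in T) ->
  has_dim (@wt_space K M mu) (size T).
Proof.
move=> uT Tmu muT.
apply: (expands_dim coordP coord_dual (W := @wt_space K M mu) uT).
- by move=> t /Tmu[vt _]; apply: basis_vec_neq0.
- exact: wt_space0.
- exact: wt_spaceP.
- by move=> t /Tmu[_ <-]; apply: wt_basis_vec.
- by move=> w _; apply: expands_all.
- move=> w t ww tT; have [vt|/negPn/eqP ->] := boolP (valid t); last by left.
  right; apply/eqP; apply: contraNT tT => /(wt_coord ww) e.
  exact: muT.
Qed.

Lemma hval_inj (m m' : 'rV[int]_4) : \sum_j m 0 j = 0 -> \sum_j m' 0 j = 0 ->
  (forall k, hval m k = hval m' k) -> m = m'.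
Proof.
move=> s0 s0' e; apply/eqP; rewrite -subr_eq0; apply/eqP/hval_eq0 => [|k].
  by under eq_bigr => j _ do rewrite 2!mxE; rewrite sumrB s0 s0' subrr.
have E l : (m - m') 0 l = m 0 l - m' 0 l by rewrite 2!mxE.
by move: (e k); rewrite /hval !E; lia.
Qed.

Lemma sum_pos1 t : \sum_j pos1 t 0 j = 0.
Proof. by have /andP[/eqP] := cone_pos1 t. Qed.

Lemma sum_pos2 t : \sum_j pos2 t 0 j = 0.
Proof. by have /andP[/eqP] := cone_pos2 t. Qed.

Lemma wt1_inj : injective (wt1 K).
Proof.
move=> t t' e; apply/pos1_inj/hval_inj; rewrite ?sum_pos1 // => k.
by have /rowP/(_ k) := e; rewrite !mxE => /intr_inj.
Qed.

Lemma wt2_inj : injective (wt2 K).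
Proof.
move=> t t' e; apply/pos2_inj/hval_inj; rewrite ?sum_pos2 // => k.
by have /rowP/(_ k) := e; rewrite !mxE => /oppr_inj/intr_inj.
Qed.

(** Each of the two parabolic Verma modules has weight multiplicities at most 1, since
    the three roots of its nilradical are linearly independent; their highest weight
    vectors come from the same vector of M, whence the correction at weight 0. *)
Lemma wt_char mu : exists2 n, has_dim (@wt_space K M mu) n &
  n%:Z = `[< exists t, mu = wt1 K t >]%:Z + `[< exists t, mu = wt2 K t >]%:Z
         - (mu == 0)%:Z.
Proof.
have wt10 t : wt1 K t = 0 -> t = t0 by rewrite -wt1_0 => /wt1_inj.
have wt20 t : wt2 K t = 0 -> t = t0 by rewrite -wt2_0 => /wt2_inj.
have [[t et]|n1] := pselect (exists t, mu = wt1 K t); last first.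
  have mu0 : mu != 0 by apply/eqP => mu0; apply: n1; exists t0; rewrite wt1_0.
  rewrite (negbTE mu0) asboolF //.
  have [[t et]|n2] := pselect (exists t, mu = wt2 K t); last first.
    exists 0%N; last by rewrite asboolF.
    apply: (@wt_dim mu [::]) => // -[[] t] _ /esym e; first by case: n1; exists t.
    by case: n2; exists t.
  have tn0 : t != t0 by apply: contra mu0 => /eqP tt; rewrite et tt wt2_0.
  exists 1%N; last by rewrite asboolT //; exists t.
  apply: (@wt_dim mu [:: (false, t)]) => // [t'|[[] t'] _ /esym e].
  - by rewrite mem_seq1 => /eqP ->; split; [rewrite /valid xpair_eqE|rewrite et].
  - by case: n1; exists t'.
  - by rewrite mem_seq1 xpair_eqE /=; apply/eqP/wt2_inj; rewrite -et.
rewrite asboolT; last by exists t.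
have [[t' et']|n2] := pselect (exists t, mu = wt2 K t); last first.
  have mu0 : mu != 0 by apply/eqP => mu0; apply: n2; exists t0; rewrite wt2_0.
  exists 1%N; last by rewrite asboolF // (negbTE mu0).
  apply: (@wt_dim mu [:: (true, t)]) => // [s|[[] s] _ /esym e].
  - by rewrite mem_seq1 => /eqP ->.
  - by rewrite mem_seq1 xpair_eqE /=; apply/eqP/wt1_inj; rewrite -et.
  - by case: n2; exists s.
rewrite asboolT; last by exists t'.
have [mu0|mu0] := eqVneq mu 0.
  exists 1%N => //; have tt : t = t0 by apply: wt10; rewrite -et.
  apply: (@wt_dim mu [:: (true, t)]) => // [s|[[] s] vs /esym e].
  - by rewrite mem_seq1 => /eqP ->.
  - by rewrite mem_seq1 xpair_eqE /=; apply/eqP/wt1_inj; rewrite -et.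
  - by move: vs; rewrite (wt20 s) // -mu0 e.
have tn0 : t' != t0 by apply: contra mu0 => /eqP tt; rewrite et' tt wt2_0.
exists 2%N => //.
have T_mu s : s \in [:: (true, t); (false, t')] -> valid s /\ wtt s = mu.
  rewrite in_cons mem_seq1 => /orP[/eqP ->|/eqP ->]; first by split; rewrite ?et.
  by split; [rewrite /valid xpair_eqE|rewrite et'].
apply: (@wt_dim mu [:: (true, t); (false, t')]) T_mu _ => // -[[] s] vs /esym e.
  have -> : s = t by apply: wt1_inj; rewrite -et.
  exact: mem_head.
have -> : s = t' by apply: wt2_inj; rewrite -et'.
by rewrite in_cons mem_head orbT.
Qed.

End Coordinates.

Lemma MM_char (K : numFieldType) mu : exists2 n, has_dim (@wt_space K (MM K) mu) n &
  n%:Z = `[< exists t, mu = wt1 K t >]%:Z + `[< exists t, mu = wt2 K t >]%:Z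
         - (mu == 0)%:Z.
Proof.
have [h1 h1v] := MM_map (null_vac1 K).
have [h2 h2v] := MM_map (null_vac2 K).
apply: (wt_char h1v h2v (U_f_MM_vac K) (U_ac_MM_vac K) (@MM_cyclic K) (@MM_vac_gens K)).
Qed.

(** * Geometric series and the numerator *)

Lemma positive_pairs :
  [seq p : 'I_4 * 'I_4 <- index_enum ('I_4 * 'I_4)%type | (p.1 < p.2)%N] =
  [:: (i0, i1); (i0, i2); (i0, i3); (i1, i2); (i1, i3); (i2, i3)].
Proof.
have enum4 : enum 'I_4 = [:: i0; i1; i2; i3].
  by apply: (inj_map val_inj); rewrite val_enum_ord.
have -> : index_enum ('I_4 * 'I_4)%type = prod_enum 'I_4 'I_4.
  by rewrite [LHS]unlock Finite.enum.unlock.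
by rewrite /prod_enum enum4.
Qed.

Section Characters.
Context (K : numFieldType).
Local Notation weight := (weight K).
Local Notation fchar := (fchar K).
Local Notation root := (sl4_root K).
Implicit Types (mu : weight) (f g : fchar).

Lemma fmul_seq f g mu (s : seq weight) : uniq s ->
  (forall nu, nu \notin s -> f nu * g (mu - nu) = 0) ->
  fmul f g mu = \sum_(nu <- s) f nu * g (mu - nu).
Proof.
move=> us fs; rewrite /fmul (@fsbigE _ _ _ _ _ s) //.
  by apply: eq_bigl => nu; rewrite in_setT.
by move=> nu _; apply: fs.
Qed.

Lemma fmul_fexps (s : seq (int * weight)) f g mu :
  (forall nu, f nu = \sum_(x <- s) x.1 * fexp x.2 nu) ->
  fmul f g mu = \sum_(x <- s) x.1 * g (mu - x.2).
Proof.
move=> fE; rewrite /fexp in fE.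
rewrite (@fmul_seq _ _ _ (undup (map snd s))) ?undup_uniq //; last first.
  move=> nu; rewrite mem_undup => nus; rewrite fE big_seq big1 ?mul0r // => x xs.
  by case: eqP nus => [->|_ _]; rewrite ?mulr0 // map_f.
under eq_bigr => nu _ do rewrite fE mulr_suml.
rewrite exchange_big big_seq [RHS]big_seq; apply: eq_bigr => x xs /=.
rewrite (bigD1_seq x.2) ?undup_uniq ?mem_undup ?map_f //= eqxx mulr1 big1 ?addr0 //.
by move=> nu /negbTE ->; rewrite mulr0 mul0r.
Qed.

Lemma mulrn_weight_inj (a : weight) : a != 0 -> injective (fun k => a *+ k).
Proof.
move=> a0 k l /eqP; rewrite -subr_eq0 -!scaler_nat -scalerBl scaler_eq0 (negbTE a0).
by rewrite orbF subr_eq0 eqr_nat => /eqP.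
Qed.

Lemma fgeom_mulE a f mu N : a != 0 -> (forall k, (N <= k)%N -> f (mu + a *+ k) = 0) ->
  fmul (fgeom a) f mu = \sum_(k < N) f (mu + a *+ k).
Proof.
move=> a0 fN; rewrite (@fmul_seq _ _ _ [seq - (a *+ k) | k <- iota 0 N]).
- rewrite big_map -[N in iota 0 N]subn0 big_mkord; apply: eq_bigr => k _.
  by rewrite opprK /fgeom asboolT ?mul1r //; exists k.
- rewrite map_inj_uniq ?iota_uniq // => k l /oppr_inj.
  exact: mulrn_weight_inj.
- move=> nu; rewrite /fgeom; case: asboolP => [[k ->] nk|_ _]; last by rewrite mul0r.
  rewrite opprK fN ?mulr0 // leqNgt; apply: contra nk => kN.
  by apply: map_f; rewrite mem_iota add0n.
Qed.

Definition alpha1 := root i0 i1.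
Definition alpha2 := root i1 i2.
Definition alpha3 := root i2 i3.
(** Coordinates on the root lattice. *)
Definition comb p q r : weight := alpha1 *+ p + alpha2 *+ q + alpha3 *+ r.

Lemma combD p q r p' q' r' :
  comb p q r + comb p' q' r' = comb (p + p') (q + q') (r + r').
Proof.
rewrite /comb !mulrnDr addrACA; congr (_ + _).
by rewrite addrACA.
Qed.

Lemma comb_muln p q r k : comb p q r *+ k = comb (p * k) (q * k) (r * k).
Proof. by rewrite /comb !mulrnDl !mulrnA. Qed.

Lemma rootE (i j k : 'I_4) : root i k = root i j + root j k.
Proof. by apply/rowP => l; rewrite !mxE; ring. Qed.

Lemma root01 : root i0 i1 = comb 1 0 0. Proof. by rewrite /comb !addr0. Qed.
Lemma root12 : root i1 i2 = comb 0 1 0. Proof. by rewrite /comb addr0 add0r. Qed.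
Lemma root23 : root i2 i3 = comb 0 0 1. Proof. by rewrite /comb !add0r. Qed.
Lemma root02 : root i0 i2 = comb 1 1 0.
Proof. by rewrite (rootE i0 i1) /comb !addr0. Qed.
Lemma root13 : root i1 i3 = comb 0 1 1.
Proof. by rewrite (rootE i1 i2) /comb add0r. Qed.
Lemma root03 : root i0 i3 = comb 1 1 1.
Proof. by rewrite (rootE i0 i2) root02 /comb !addr0. Qed.

Lemma alpha1E k : alpha1 0 k = nth 0 [:: 2; -1; 0] k.
Proof. by elim/ord3P: k; rewrite !mxE /=; ring. Qed.
Lemma alpha2E k : alpha2 0 k = nth 0 [:: -1; 2; -1] k.
Proof. by elim/ord3P: k; rewrite !mxE /=; ring. Qed.
Lemma alpha3E k : alpha3 0 k = nth 0 [:: 0; -1; 2] k.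
Proof. by elim/ord3P: k; rewrite !mxE /=; ring. Qed.

(** The entries come from the columns of the Cartan matrix. *)
Lemma combE p q r k : comb p q r 0 k =
  nth 0 [:: 2 * p%:R - q%:R; - p%:R + 2 * q%:R - r%:R; - q%:R + 2 * r%:R] k.
Proof.
have E x n (y : weight) : (y *+ n) 0 x = y 0 x *+ n by rewrite mulmxnE.
rewrite /comb [LHS]mxE [X in X + _]mxE !E.
rewrite alpha1E alpha2E alpha3E.
by elim/ord3P: k => /=; ring.
Qed.

(* The coefficients below are 4 times the inverse of the Cartan matrix. *)
Lemma comb_inj p q r p' q' r' : comb p q r = comb p' q' r' ->
  [/\ p = p', q = q' & r = r'].
Proof.
move=> /rowP e; have := e node1; have := e node2; have := e node3.
rewrite !combE /= => e3 e2 e1.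
have four : 4%:R != 0 :> K by rewrite pnatr_eq0.
have natK (x y : nat) : 4%:R * x%:R = 4%:R * y%:R :> K -> x = y.
  by move=> /(mulfI four) /eqP; rewrite eqr_nat => /eqP.
split; apply: natK.
- have -> : 4%:R * p%:R = 3 * (2 * p%:R - q%:R) + 2 * (- p%:R + 2 * q%:R - r%:R)
    + (- q%:R + 2 * r%:R) :> K by ring.
  rewrite e1 e2 e3; ring.
- have -> : 4%:R * q%:R = 2 * (2 * p%:R - q%:R) + 4 * (- p%:R + 2 * q%:R - r%:R)
    + 2 * (- q%:R + 2 * r%:R) :> K by ring.
  rewrite e1 e2 e3; ring.
- have -> : 4%:R * r%:R = (2 * p%:R - q%:R) + 2 * (- p%:R + 2 * q%:R - r%:R)
    + 3 * (- q%:R + 2 * r%:R) :> K by ring.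
  rewrite e1 e2 e3; ring.
Qed.

(** Support in the cone spanned by the negative roots: this is what makes the sums
    over k >= 0 in products with geometric series finite. *)
Definition cone_supp f := forall mu, f mu != 0 -> exists p q r, mu = - comb p q r.

Lemma comb0 : comb 0 0 0 = 0. Proof. by rewrite /comb !addr0. Qed.

Lemma comb_neq0 p q r : (0 < p + q + r)%N -> comb p q r != 0.
Proof.
move=> h; apply/eqP; rewrite -comb0 => /comb_inj[e1 e2 e3].
by move: h; rewrite e1 e2 e3.
Qed.

Definition geom p q r f : fchar := fmul (fgeom (comb p q r)) f.

(** Multiplication by 1 - e^(-a). *)
Definition diff (a : weight) f : fchar := fun mu => f mu - f (mu + a).

(** Comparing coordinates of two points of the cone on the same line bounds k. *)
Lemma cone_supp_bound f mu p q r : cone_supp f -> (0 < p + q + r)%N ->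
  exists N, forall k, (N <= k)%N -> f (mu + comb p q r *+ k) = 0.
Proof.
move=> cf h; have [[k0 fk0]|none] := pselect (exists k, f (mu + comb p q r *+ k) != 0).
  have [p0 [q0 [r0 e0]]] := cf _ fk0.
  exists (p0 + q0 + r0 + k0).+1 => k hk; apply/eqP/negP => /negP fk.
  have [p1 [q1 [r1 e1]]] := cf _ fk.
  have : comb p1 q1 r1 + comb p q r *+ k = comb p0 q0 r0 + comb p q r *+ k0.
    have aux (m c0 c1 x y : weight) : m + x = - c0 -> m + y = - c1 -> c1 + y = c0 + x.
      by move=> e e'; rewrite -[c0]opprK -e -[c1]opprK -e' !opprD !addrNK.
    exact: aux e0 e1.
  rewrite !comb_muln !combD => /comb_inj[].
  nia.
exists 0%N => k _; apply/eqP/negP => /negP fk; apply: none; by exists k.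
Qed.

(** The sum telescopes. *)
Lemma diff_geomK p q r f : cone_supp f -> (0 < p + q + r)%N ->
  diff (comb p q r) (geom p q r f) = f.
Proof.
move=> cf h; apply/funext => mu; have a0 := comb_neq0 h; rewrite /geom.
set a := comb p q r; have [N HN] := cone_supp_bound mu cf h.
rewrite /diff (@fgeom_mulE a f mu N.+1) //; last by move=> k /ltnW; apply: HN.
rewrite (@fgeom_mulE a f (mu + a) N) //; last first.
  by move=> k Nk; rewrite -addrA -mulrS; apply: HN; apply: leqW.
rewrite big_ord_recl mulr0n addr0 -addrA; under [X in _ - X]eq_bigr => k _ do
  rewrite -addrA -mulrS.
by rewrite subrr addr0.
Qed.

Lemma cone_supp_geom p q r f : cone_supp f -> (0 < p + q + r)%N ->
  cone_supp (geom p q r f).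
Proof.
move=> cf h mu; have [N HN] := cone_supp_bound mu cf h.
rewrite /geom (fgeom_mulE (comb_neq0 h) HN) => nz.
have [k fk] : exists k : 'I_N, f (mu + comb p q r *+ k) != 0.
  apply/existsP; apply: contraNT nz => /existsPn H; apply/eqP/big1 => k _.
  by have := H k; rewrite negbK => /eqP.
have [p1 [q1 [r1 e1]]] := cf _ fk.
exists (p1 + p * k)%N, (q1 + q * k)%N, (r1 + r * k)%N.
by rewrite -combD -comb_muln opprD -e1 addrK.
Qed.

Lemma diff_geom b p q r f : cone_supp f -> (0 < p + q + r)%N ->
  diff b (geom p q r f) = geom p q r (diff b f).
Proof.
move=> cf h; apply/funext => mu; have a0 := comb_neq0 h; rewrite /geom.
have [N HN] := cone_supp_bound mu cf h.
have [N' HN'] := cone_supp_bound (mu + b) cf h.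
have HN2 k : (maxn N N' <= k)%N -> f (mu + b + comb p q r *+ k) = 0.
  by rewrite geq_max => /andP[_ ?]; apply: HN'.
have HN1 k : (maxn N N' <= k)%N -> f (mu + comb p q r *+ k) = 0.
  by rewrite geq_max => /andP[? _]; apply: HN.
rewrite /diff (fgeom_mulE a0 HN1) (fgeom_mulE a0 HN2) (@fgeom_mulE _ _ _ (maxn N N')) //.
  by rewrite -sumrB; apply: eq_bigr => k _; rewrite addrAC.
by move=> k hk; rewrite HN1 // addrAC HN2 // subr0.
Qed.

Lemma cone_supp_fexp0 : cone_supp (fexp 0).
Proof.
move=> mu; rewrite /fexp; case: (mu =P 0) => // -> _.
by exists 0%N, 0%N, 0%N; rewrite comb0 oppr0.
Qed.

(** Uniqueness of k makes all coefficients of the product 0 or 1; it holds when a is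
    independent of the directions of X. *)
Lemma fgeom_mul_indicator (a : weight) (X : weight -> Prop) : a != 0 ->
    (forall mu k l, X (mu + a *+ k) -> X (mu + a *+ l) -> k = l) ->
  fmul (fgeom a) (fun mu => `[< X mu >]%:Z) =
  fun mu => `[< exists k, X (mu + a *+ k) >]%:Z.
Proof.
move=> a0 uX; apply/funext => mu.
have [[k Xk]|none] := pselect (exists k, X (mu + a *+ k)).
  rewrite (@fgeom_mulE _ _ _ k.+1) // => [|l kl]; last first.
    by rewrite asboolF // => /(uX _ _ _ Xk) e; move: kl; rewrite e ltnn.
  rewrite big_ord_recr big1 /= => [|l _]; last first.
    by rewrite asboolF // => /(uX _ _ _ Xk) e; have := ltn_ord l; rewrite -e ltnn.
  by rewrite !asboolT //; exists k.
rewrite (@fgeom_mulE _ _ _ 0%N) // => [|l _].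
  by rewrite big_ord0 asboolF.
by rewrite asboolF // => Xl; apply: none; exists l.
Qed.

Lemma weyl_denomE : weyl_denom_inv K =
  geom 1 0 0 (geom 1 1 0 (geom 1 1 1
    (geom 0 1 0 (geom 0 1 1 (geom 0 0 1 (fexp 0)))))).
Proof.
rewrite /weyl_denom_inv -big_filter positive_pairs.
by rewrite !big_cons big_nil /= root01 root02 root03 root12 root13 root23.
Qed.

(* Products of geometric series with e^0 are supported in the cone. *)
Ltac solve_cone_supp := do ?[apply: cone_supp_geom; last by []]; exact: cone_supp_fexp0.

(** The factors 1 - e^(-a) for the roots a = alpha_2, alpha_2 + alpha_3, alpha_3 leave
    the product of the geometric series over the roots of the nilradical of rep1. *)
Lemma diff_weyl_denom1 :
  diff (comb 0 1 0) (diff (comb 0 1 1) (diff (comb 0 0 1) (weyl_denom_inv K))) =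
  geom 1 0 0 (geom 1 1 0 (geom 1 1 1 (fexp 0))).
Proof.
rewrite weyl_denomE.
do 5! [rewrite [diff (comb 0 0 1) _]diff_geom; [|solve_cone_supp|by []]].
rewrite diff_geomK; [|solve_cone_supp|by []].
do 4! [rewrite [diff (comb 0 1 1) _]diff_geom; [|solve_cone_supp|by []]].
rewrite diff_geomK; [|solve_cone_supp|by []].
do 3! [rewrite [diff (comb 0 1 0) _]diff_geom; [|solve_cone_supp|by []]].
by rewrite diff_geomK; [|solve_cone_supp|by []].
Qed.

(** Likewise for the roots alpha_1, alpha_1 + alpha_2, alpha_2 and rep2. *)
Lemma diff_weyl_denom2 :
  diff (comb 1 0 0) (diff (comb 1 1 0) (diff (comb 0 1 0) (weyl_denom_inv K))) =
  geom 1 1 1 (geom 0 1 1 (geom 0 0 1 (fexp 0))).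
Proof.
rewrite weyl_denomE.
do 3! [rewrite [diff (comb 0 1 0) _]diff_geom; [|solve_cone_supp|by []]].
rewrite diff_geomK; [|solve_cone_supp|by []].
rewrite [diff (comb 1 1 0) _]diff_geom; [|solve_cone_supp|by []].
rewrite [diff (comb 1 1 0) _]diff_geomK; [|solve_cone_supp|by []].
by rewrite diff_geomK; [|solve_cone_supp|by []].
Qed.

Lemma diff_weyl_denom_all : diff (comb 1 1 1) (diff (comb 1 1 0) (diff (comb 1 0 0)
  (diff (comb 0 1 0) (diff (comb 0 1 1) (diff (comb 0 0 1) (weyl_denom_inv K)))))) = fexp 0.
Proof.
rewrite diff_weyl_denom1.
rewrite diff_geomK; [|solve_cone_supp|by []].
rewrite diff_geomK; [|solve_cone_supp|by []].
by rewrite diff_geomK; [|solve_cone_supp|by []].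
Qed.

Lemma wt1E i j k : wt1 K (i, j, k) = - comb (i + j + k) (j + k) k.
Proof.
apply/rowP => l; rewrite [RHS]mxE combE mxE /hval.
by elim/ord3P: l; rewrite !mxE /= ?intrB ?intrN -?pmulrn ?natrD; ring.
Qed.

Lemma wt2E i j k : wt2 K (i, j, k) = - comb k (j + k) (i + j + k).
Proof.
apply/rowP => l; rewrite [RHS]mxE combE mxE /hval.
by elim/ord3P: l; rewrite !mxE /= ?intrB ?intrN -?pmulrn ?natrD; ring.
Qed.

Local Notation P := (weyl_denom_inv K).

Lemma fexp0_indicator : fexp (0 : weight) = fun mu => `[< mu = 0 >]%:Z.
Proof.
apply/funext => mu; rewrite /fexp; congr (nat_of_bool _)%:Z.
by apply/eqP/asboolP.
Qed.

Lemma geom_indicator p q r (X : weight -> Prop) : (0 < p + q + r)%N ->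
    (forall mu k l, X (mu + comb p q r *+ k) -> X (mu + comb p q r *+ l) -> k = l) ->
  geom p q r (fun mu => `[< X mu >]%:Z) =
  fun mu => `[< exists k, X (mu + comb p q r *+ k) >]%:Z.
Proof. by move=> h; apply: fgeom_mul_indicator; apply: comb_neq0. Qed.

Lemma add_eq0_inj mu x y : mu + x = 0 -> mu + y = 0 -> x = y.
Proof. by move=> <- /addrI. Qed.

Lemma geom_wt1 mu : geom 1 0 0 (geom 1 1 0 (geom 1 1 1 (fexp 0))) mu =
  `[< exists t, mu = wt1 K t >]%:Z.
Proof.
rewrite fexp0_indicator geom_indicator // => [|nu k l e1 e2]; last first.
  by have := add_eq0_inj e1 e2; rewrite !comb_muln => /comb_inj[]; lia.
rewrite geom_indicator // => [|nu k l [k' e1] [l' e2]]; last first.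
  move: e1 e2; rewrite -!addrA => e1 e2.
  by have := add_eq0_inj e1 e2; rewrite !comb_muln !combD => /comb_inj[]; lia.
rewrite geom_indicator // => [|nu k l [k' [k2 e1]] [l' [l2 e2]]]; last first.
  move: e1 e2; rewrite -!addrA => e1 e2.
  by have := add_eq0_inj e1 e2; rewrite !comb_muln !combD => /comb_inj[]; lia.
congr (nat_of_bool _)%:Z; apply: asbool_equiv_eq; split=> [[i [j [k e]]]|[[[i j] k] ->]].
  exists (i, j, k); rewrite wt1E; apply/eqP; rewrite -addr_eq0; apply/eqP.
  rewrite -[RHS]e -!addrA !comb_muln !combD; congr (_ + comb _ _ _); lia.
exists i, j, k; rewrite wt1E -!addrA !comb_muln !combD addrC.
apply/eqP; rewrite subr_eq0; apply/eqP; congr (comb _ _ _); lia.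
Qed.

Lemma geom_wt2 mu : geom 1 1 1 (geom 0 1 1 (geom 0 0 1 (fexp 0))) mu =
  `[< exists t, mu = wt2 K t >]%:Z.
Proof.
rewrite fexp0_indicator geom_indicator // => [|nu k l e1 e2]; last first.
  by have := add_eq0_inj e1 e2; rewrite !comb_muln => /comb_inj[]; lia.
rewrite geom_indicator // => [|nu k l [k' e1] [l' e2]]; last first.
  move: e1 e2; rewrite -!addrA => e1 e2.
  by have := add_eq0_inj e1 e2; rewrite !comb_muln !combD => /comb_inj[]; lia.
rewrite geom_indicator // => [|nu k l [k' [k2 e1]] [l' [l2 e2]]]; last first.
  move: e1 e2; rewrite -!addrA => e1 e2.
  by have := add_eq0_inj e1 e2; rewrite !comb_muln !combD => /comb_inj[]; lia.
congr (nat_of_bool _)%:Z; apply: asbool_equiv_eq; split=> [[k [j [i e]]]|[[[i j] k] ->]].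
  exists (i, j, k); rewrite wt2E; apply/eqP; rewrite -addr_eq0; apply/eqP.
  rewrite -[RHS]e -!addrA !comb_muln !combD; congr (_ + comb _ _ _); lia.
exists k, j, i; rewrite wt2E -!addrA !comb_muln !combD addrC.
apply/eqP; rewrite subr_eq0; apply/eqP; congr (comb _ _ _); lia.
Qed.

(** The signs and exponents w . 0 of N, in the order of the sixteen terms of N. *)
Definition numer_terms : seq (int * weight) :=
  [:: (1, - comb 0 0 0); (-1, - comb 0 1 0); (-1, - comb 1 0 1); (1, - comb 2 1 2);
      (1, - comb 1 3 1); (1, - comb 1 2 3); (1, - comb 3 2 1); (-1, - comb 1 3 3);
      (-1, - comb 2 2 3); (-1, - comb 3 3 1); (-1, - comb 3 2 2); (1, - comb 2 4 3);
      (1, - comb 3 4 2); (-1, - comb 2 4 2); (1, - comb 3 3 3); (-1, - comb 3 4 3)].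

(** With x, y, t the exponentials of the negative simple roots, the product of N and
    the geometric series is evaluated through the polynomial identity
    N = (1 - y) (1 - y t) (1 - t) + (1 - x) (1 - x y) (1 - y)
        - (1 - x) (1 - y) (1 - t) (1 - x y) (1 - y t) (1 - x y t). *)
Lemma numer_identity mu :
  \sum_(x <- numer_terms) x.1 * P (mu - x.2) =
  `[< exists t, mu = wt1 K t >]%:Z + `[< exists t, mu = wt2 K t >]%:Z - (mu == 0)%:Z.
Proof.
rewrite -geom_wt1 -diff_weyl_denom1 -geom_wt2 -diff_weyl_denom2.
rewrite -[X in _ = _ - X]/(fexp 0 mu) -diff_weyl_denom_all.
have [F PF] : exists F, forall p q r, P (mu + comb p q r) = F p q r.
  by exists (fun p q r => P (mu + comb p q r)).
have D x y z f G : (forall p q r, f (mu + comb p q r) = G p q r) ->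
    forall p q r, diff (comb x y z) f (mu + comb p q r) =
      G p q r - G (p + x)%N (q + y)%N (r + z)%N.
  by move=> fG p q r; rewrite /diff -addrA combD !fG.
have mu0 : mu = mu + comb 0 0 0 by rewrite comb0 addr0.
rewrite [in RHS]mu0.
rewrite (D 0 1 0 _ _ (D 0 1 1 _ _ (D 0 0 1 _ _ PF)))%N.
rewrite (D 1 0 0 _ _ (D 1 1 0 _ _ (D 0 1 0 _ _ PF)))%N.
rewrite (D 1 1 1 _ _ (D 1 1 0 _ _ (D 1 0 0 _ _
          (D 0 1 0 _ _ (D 0 1 1 _ _ (D 0 0 1 _ _ PF))))))%N.
rewrite /numer_terms !big_cons big_nil /= !opprK !PF.
move: F {PF D mu0} => F; cbv [addn Nat.add].
ring.
Qed.

End Characters.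

(** * The Weyl group *)

(** A simple reflection on the values of a weight at h_1, h_2, h_3. *)
Definition refl3 (T : zmodType) (k : 'I_3) (x : T * T * T) : T * T * T :=
  let: (x1, x2, x3) := x in
  if val k is 0 then (- x1, x2 + x1, x3)
  else if val k is 1 then (x1 + x2, - x2, x3 + x2)
  else (x1, x2 + x3, - x3).

(** The action of a word on a generic weight, whose values at h_1, h_2, h_3 are
    independent linear forms with integer coefficients. *)
Definition word_mx (w : seq 'I_3) : (int * int * int) * (int * int * int) * (int * int * int) :=
  foldr (@refl3 _) ((1, 0, 0), (0, 1, 0), (0, 0, 1)) w.

(** A reduced word for each of the 24 elements of the Weyl group. *)
Definition short_words : seq (seq 'I_3) :=
  let s1 := node1 in let s2 := node2 in let s3 := node3 in
  [:: [::]; [:: s1]; [:: s2]; [:: s3];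
      [:: s1; s2]; [:: s2; s1]; [:: s2; s3]; [:: s3; s2]; [:: s1; s3];
      [:: s1; s2; s1]; [:: s2; s3; s2]; [:: s1; s2; s3]; [:: s3; s2; s1];
      [:: s2; s1; s3]; [:: s1; s3; s2];
      [:: s1; s2; s1; s3]; [:: s3; s1; s2; s1]; [:: s1; s2; s3; s2]; [:: s2; s3; s2; s1];
      [:: s2; s1; s3; s2];
      [:: s1; s2; s1; s3; s2]; [:: s2; s1; s3; s2; s1]; [:: s1; s2; s3; s2; s1];
      [:: s1; s2; s1; s3; s2; s1]].

Definition long_word : seq 'I_3 := [:: node1; node2; node1; node3; node2; node1].

Lemma short_words_step : all (fun c => all (fun k => has (fun c' =>
    (word_mx (k :: c) == word_mx c') && (size c' <= (size c).+1)%N) short_words)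
  [:: node1; node2; node3]) short_words.
Proof. by vm_compute. Qed.

Lemma short_wordsP w : exists c,
  [/\ c \in short_words, word_mx w = word_mx c & (size c <= size w)%N].
Proof.
elim: w => [|k w [c [cc wc sc]]]; first by exists [::].
have /allP/(_ c cc)/allP/(_ k) := short_words_step.
have -> : k \in [:: node1; node2; node3].
  by case: k => [[|[|[|//]]] lt3]; rewrite (bool_irrelevance lt3 isT).
move=> /(_ isT)/hasP[c' cc' /andP[/eqP e sc']]; exists c'; split=> //.
  by rewrite -e /= wc.
exact: leq_trans sc' _.
Qed.

(** The image of rho, whose values at h_1, h_2, h_3 are all 1. *)
Definition rho_img (w : seq 'I_3) : int * int * int := foldr (@refl3 _) (1, 1, 1) w.

Lemma short_words_long : all (fun c => [&& (size c <= 6)%N,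
   (size c == 6)%N ==> (rho_img c == (-1, -1, -1)) &
   (rho_img c == (-1, -1, -1)) ==> (size c == 6)%N]) short_words.
Proof. by vm_compute. Qed.

Section Weyl.
Context (K : numFieldType).
Local Notation weight := (weight K).
Local Notation comb := (comb K).

Definition wt3 (x : K * K * K) : weight := \row_k nth 0 [:: x.1.1; x.1.2; x.2] k.

Lemma wt3K (mu : weight) : mu = wt3 (mu 0 node1, mu 0 node2, mu 0 node3).
Proof. by apply/rowP; elim/ord3P; rewrite mxE. Qed.

Lemma wt3_inj : injective wt3.
Proof.
move=> [[a b] c] [[a' b'] c'] e; have E k := congr1 (fun m : weight => m 0 k) e.
by have := E node1; have := E node2; have := E node3; rewrite !mxE /= => -> -> ->.
Qed.

Lemma simple_root1 : simple_root K node1 = comb 1 0 0.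
Proof. by rewrite -root01 /simple_root; congr sl4_root; apply/val_inj. Qed.
Lemma simple_root2 : simple_root K node2 = comb 0 1 0.
Proof. by rewrite -root12 /simple_root; congr sl4_root; apply/val_inj. Qed.
Lemma simple_root3 : simple_root K node3 = comb 0 0 1.
Proof. by rewrite -root23 /simple_root; congr sl4_root; apply/val_inj. Qed.

Lemma simple_reflE k x : simple_reflection k (wt3 x) = wt3 (refl3 k x).
Proof.
case: x => [[a b] c]; elim/ord3P: k; rewrite /simple_reflection.
- rewrite simple_root1; apply/rowP => l; rewrite [LHS]mxE [X in _ + X]mxE [X in _ - X]mxE combE.
  by elim/ord3P: l; rewrite !mxE /=; ring.
- rewrite simple_root2; apply/rowP => l; rewrite [LHS]mxE [X in _ + X]mxE [X in _ - X]mxE combE.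
  by elim/ord3P: l; rewrite !mxE /=; ring.
- rewrite simple_root3; apply/rowP => l; rewrite [LHS]mxE [X in _ + X]mxE [X in _ - X]mxE combE.
  by elim/ord3P: l; rewrite !mxE /=; ring.
Qed.

Lemma weyl_act3 w x : weyl_act w (wt3 x) = wt3 (foldr (@refl3 _) x w).
Proof. by elim: w => //= k w ->; rewrite simple_reflE. Qed.

Definition map3 (T T' : Type) (h : T -> T') (x : T * T * T) := (h x.1.1, h x.1.2, h x.2).

Lemma refl3_map (T T' : zmodType) (h : {additive T -> T'}) k x :
  refl3 k (map3 h x) = map3 h (refl3 k x).
Proof.
case: x => [[a b] c]; rewrite /refl3 /map3 /=.
by case: (val k) => [|[|n]] /=; rewrite !(raddfD, raddfN).
Qed.

Lemma foldr_refl3_map (T T' : zmodType) (h : {additive T -> T'}) w x :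
  foldr (@refl3 _) (map3 h x) w = map3 h (foldr (@refl3 _) x w).
Proof. by elim: w => //= k w ->; rewrite refl3_map. Qed.

Definition eval3 (a b c : K) (x : int * int * int) : K :=
  x.1.1%:~R * a + x.1.2%:~R * b + x.2%:~R * c.

Lemma eval3_additive a b c : zmod_morphism (eval3 a b c).
Proof. by move=> x y; rewrite /eval3 /= !intrB; ring. Qed.

HB.instance Definition _ a b c :=
  GRing.isZmodMorphism.Build (int * int * int)%type K (eval3 a b c) (eval3_additive a b c).

Lemma weyl_act_mx w w' : word_mx w = word_mx w' -> weyl_act (K := K) w =1 weyl_act w'.
Proof.
move=> e mu; rewrite (wt3K mu) !weyl_act3; congr wt3.
move: (mu 0 node1) (mu 0 node2) (mu 0 node3) => a b c.
have -> : (a, b, c) = map3 (eval3 a b c) ((1, 0, 0), (0, 1, 0), (0, 0, 1)).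
  by rewrite /map3 /eval3 /=; congr (_, _, _); ring.
by rewrite !foldr_refl3_map; congr map3.
Qed.

Lemma rhoE : rho K = wt3 (1, 1, 1).
Proof.
rewrite /rho -big_filter positive_pairs !big_cons big_nil /=.
rewrite root01 root02 root03 root12 root13 root23 addr0 !combD.
apply/rowP => l; rewrite [LHS]mxE combE; elim/ord3P: l; rewrite !mxE /=; by field.
Qed.

Lemma weyl_rho w : weyl_act w (rho K) = wt3 (map3 intr (rho_img w)).
Proof.
by rewrite rhoE weyl_act3 -foldr_refl3_map.
Qed.

Lemma dot_act0 w (p q r : nat) :
  rho_img w = (1 - (2 * p%:Z - q%:Z), 1 - (- p%:Z + 2 * q%:Z - r%:Z),
               1 - (- q%:Z + 2 * r%:Z)) ->
  dot_act w 0 = - comb p q r.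
Proof.
move=> e; rewrite /dot_act add0r weyl_rho e rhoE; apply/rowP => l.
rewrite [LHS]mxE [X in _ + X]mxE [RHS]mxE combE; elim/ord3P: l; rewrite !mxE /=; ring.
Qed.

(** Every word acts like a word of the list that is at most as long, and only one
    word of the list has length 6, the maximum. That word is reduced: it sends rho to
    - rho, and so does no shorter word of the list. *)
Lemma longest_rho w0 : longest_word K w0 -> rho_img w0 = (-1, -1, -1).
Proof.
move=> [red long].
have rho_inj w w' : weyl_act (K := K) w =1 weyl_act w' -> rho_img w = rho_img w'.
  move=> e; have := e (rho K); rewrite !weyl_rho => /wt3_inj.
  move: (rho_img w) (rho_img w') => [[a b] c] [[a' b'] c'].
  by case=> /intr_inj -> /intr_inj -> /intr_inj ->.
have red6 : reduced K long_word.
  move=> w' e; have [c [cc wc sc]] := short_wordsP w'.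
  have /and3P[_ _ /implyP h] := allP short_words_long c cc.
  apply: leq_trans sc; rewrite (eqP (h _)) //; apply/eqP.
  rewrite (rho_inj c long_word) //; move=> mu; rewrite -e; apply/esym; exact: weyl_act_mx.
have s6 := long long_word red6.
have [c [cc wc sc]] := short_wordsP w0.
have e0 := weyl_act_mx wc.
have s0 : (size w0 <= size c)%N by apply: red => mu; rewrite e0.
have /and3P[s_le /implyP h _] := allP short_words_long c cc.
rewrite (rho_inj _ _ e0); apply/eqP/h; rewrite eqn_leq s_le.
exact: leq_trans s6 s0.
Qed.

End Weyl.

(** * The character of MM *)

Section Main.
Context (K : numFieldType).

(** Stated over an abstract field, so that no conversion unfolds the construction of
    the complex numbers. *)
Lemma MM_has_char w0 : longest_word K w0 ->
  let s1 := node1 in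
  let s2 := node2 in
  let s3 := node3 in
  let E (w : seq 'I_3) : fchar K := fexp (dot_act w 0) in
  let N : fchar K :=
    E [::] - E [:: s2] - E [:: s1; s3] + E [:: s1; s3; s2] + E [:: s2; s1; s3]
    + E [:: s3; s2; s1] + E [:: s1; s2; s3]
    - E [:: s2; s3; s2; s1] - E [:: s1; s3; s2; s1]
    - E [:: s2; s1; s2; s3] - E [:: s3; s1; s2; s3]
    + E [:: s2; s1; s3; s2; s1] + E [:: s2; s3; s1; s2; s3]
    - E [:: s2; s1; s3; s2] + E [:: s1; s3; s2; s1; s3]
    - E w0 in
  has_char (MM K) (fmul N (weyl_denom_inv K)).
Proof.
move=> /longest_rho w0E s1 s2 s3 E N mu.
have [n dim nE] := MM_char mu; exists n => //; rewrite nE -numer_identity.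
apply: fmul_fexps => nu.
have -> : numer_terms K = [:: (1, dot_act [::] 0); (-1, dot_act [:: s2] 0);
    (-1, dot_act [:: s1; s3] 0); (1, dot_act [:: s1; s3; s2] 0);
    (1, dot_act [:: s2; s1; s3] 0); (1, dot_act [:: s3; s2; s1] 0);
    (1, dot_act [:: s1; s2; s3] 0); (-1, dot_act [:: s2; s3; s2; s1] 0);
    (-1, dot_act [:: s1; s3; s2; s1] 0); (-1, dot_act [:: s2; s1; s2; s3] 0);
    (-1, dot_act [:: s3; s1; s2; s3] 0); (1, dot_act [:: s2; s1; s3; s2; s1] 0);
    (1, dot_act [:: s2; s3; s1; s2; s3] 0); (-1, dot_act [:: s2; s1; s3; s2] 0);
    (1, dot_act [:: s1; s3; s2; s1; s3] 0); (-1, dot_act w0 0)].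
  rewrite (@dot_act0 K w0 3 4 3 w0E).
  rewrite (@dot_act0 K [::] 0 0 0 erefl) (@dot_act0 K [:: s2] 0 1 0 erefl).
  rewrite (@dot_act0 K [:: s1; s3] 1 0 1 erefl) (@dot_act0 K [:: s1; s3; s2] 2 1 2 erefl).
  rewrite (@dot_act0 K [:: s2; s1; s3] 1 3 1 erefl) (@dot_act0 K [:: s3; s2; s1] 1 2 3 erefl).
  rewrite (@dot_act0 K [:: s1; s2; s3] 3 2 1 erefl).
  rewrite (@dot_act0 K [:: s2; s3; s2; s1] 1 3 3 erefl).
  rewrite (@dot_act0 K [:: s1; s3; s2; s1] 2 2 3 erefl).
  rewrite (@dot_act0 K [:: s2; s1; s2; s3] 3 3 1 erefl).
  rewrite (@dot_act0 K [:: s3; s1; s2; s3] 3 2 2 erefl).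
  rewrite (@dot_act0 K [:: s2; s1; s3; s2; s1] 2 4 3 erefl).
  rewrite (@dot_act0 K [:: s2; s3; s1; s2; s3] 3 4 2 erefl).
  rewrite (@dot_act0 K [:: s2; s1; s3; s2] 2 4 2 erefl).
  by rewrite (@dot_act0 K [:: s1; s3; s2; s1; s3] 3 3 3 erefl).
rewrite !big_cons big_nil.
rewrite -[LHS]/(E [::] nu - E [:: s2] nu - E [:: s1; s3] nu + E [:: s1; s3; s2] nu
  + E [:: s2; s1; s3] nu + E [:: s3; s2; s1] nu + E [:: s1; s2; s3] nu
  - E [:: s2; s3; s2; s1] nu - E [:: s1; s3; s2; s1] nu
  - E [:: s2; s1; s2; s3] nu - E [:: s3; s1; s2; s3] nu
  + E [:: s2; s1; s3; s2; s1] nu + E [:: s2; s3; s1; s2; s3] nu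
  - E [:: s2; s1; s3; s2] nu + E [:: s1; s3; s2; s1; s3] nu - E w0 nu).
have [e eE] : exists e : seq 'I_3 -> int, forall w, fexp (dot_act w 0) nu = e w.
  by exists (fun w => fexp (dot_act w 0) nu).
have EE w : E w nu = e w by rewrite -eE.
rewrite -[RHS]/(1 * E [::] nu + (-1 * E [:: s2] nu + (-1 * E [:: s1; s3] nu +
  (1 * E [:: s1; s3; s2] nu + (1 * E [:: s2; s1; s3] nu + (1 * E [:: s3; s2; s1]
  nu + (1 * E [:: s1; s2; s3] nu + (-1 * E [:: s2; s3; s2; s1] nu + (-1 * E [::
  s1; s3; s2; s1] nu + (-1 * E [:: s2; s1; s2; s3] nu + (-1 * E [:: s3; s1; s2;
  s3] nu + (1 * E [:: s2; s1; s3; s2; s1] nu + (1 * E [:: s2; s3; s1; s2; s3] nu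
  + (-1 * E [:: s2; s1; s3; s2] nu + (1 * E [:: s1; s3; s2; s1; s3] nu + (-1 * E
  w0 nu + 0)))))))))))))))).
rewrite !EE.
move: e {eE EE} => e.
ring.
Qed.

End Main.

Theorem proposition2p14 (R : realType) (w0 : seq 'I_3) :
  longest_word R[i] w0 ->
  let s1 := node1 in
  let s2 := node2 in
  let s3 := node3 in
  let E (w : seq 'I_3) : fchar R[i] := fexp (dot_act w 0) in
  let N : fchar R[i] :=
    E [::] - E [:: s2] - E [:: s1; s3] + E [:: s1; s3; s2] + E [:: s2; s1; s3]
    + E [:: s3; s2; s1] + E [:: s1; s2; s3]
    - E [:: s2; s3; s2; s1] - E [:: s1; s3; s2; s1]
    - E [:: s2; s1; s2; s3] - E [:: s3; s1; s2; s3]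
    + E [:: s2; s1; s3; s2; s1] + E [:: s2; s3; s1; s2; s3]
    - E [:: s2; s1; s3; s2] + E [:: s1; s3; s2; s1; s3]
    - E w0 in
  has_char (MM R[i]) (fmul N (weyl_denom_inv R[i])).
Proof. exact: MM_has_char. Qed.
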